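(* Let $(A,\mathfrak{g})$ be a Lie Rinehart pair with associated graded Lie algebra $A\oplus\mathfrak{g}$ (regarded as a Lie $\infty$-algebra whose only nonvanishing bracket is the binary one) and exterior algebra $\bigwedge\mathfrak{g}_A$, regarded as a Lie $\infty$-algebra with the Lie $n$-brackets $(\{\cdot,\ldots,\cdot\}_n)_{n\in\mathbb{N}}$. For $n\in\mathbb{N}$ let $$i_n:(A\oplus\mathfrak{g})\times\cdots\times(A\oplus\mathfrak{g})\to\textstyle\bigwedge\mathfrak{g}_A,\qquad (x_1,\ldots,x_n)\mapsto(-1)^{n-1}(n-1)!\cdot x_n\wedge\cdots\wedge x_1 .$$ Then the natural injection $i_\infty=(i_n)_{n\in\mathbb{N}}:A\oplus\mathfrak{g}\to\bigwedge\mathfrak{g}_A$ is a morphism of Lie $\infty$-algebras.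
   Context: A Lie Rinehart pair $(A,\mathfrak{g})$ consists of a real associative commutative algebra $A$ with unit, a real Lie algebra $\mathfrak{g}$, an $A$-module structure $(a,x)\mapsto a\cdot x$ on the vector space $\mathfrak{g}$, and a Lie algebra morphism $D:\mathfrak{g}\to \mathrm{Der}(A)$, $x\mapsto D_x$, into the Lie algebra of ($\mathbb{R}$-linear) derivations of $A$ (with commutator bracket), such that the Leibniz rule $[x,a\cdot y]=D_x(a)\cdot y+a\cdot[x,y]$ holds for all $x,y\in\mathfrak{g}$, $a\in A$. The associated graded Lie algebra of $(A,\mathfrak{g})$ is $A\oplus\mathfrak{g}$ with $A$ in degree $0$, $\mathfrak{g}$ in degree $1$, and the graded symmetric bracket of degree $-1$ given by $[(a,x),(b,y)]=(D_x(b)+D_y(a),[x,y])$. $\bigwedge\mathfrak{g}_A=\bigoplus_{n\ge0}\bigwedge^n_A\mathfrak{g}$ is the exterior algebra of the $A$-module $\mathfrak{g}$, with $\bigwedge^0_A\mathfrak{g}=A$, $\bigwedge^1_A\mathfrak{g}=\mathfrak{g}$; thus elements of $A\oplus\mathfrak{g}$ are regarded as elements of $\bigwedge\mathfrak{g}_A$. For $x\in\bigwedge^n_A\mathfrak{g}$ the tensor degree is $|x|=n$; this is the grading used. The antisymmetric Schouten-Nijenhuis bracket is the map $[\cdot,\cdot]:\bigwedge\mathfrak{g}_A\times\bigwedge\mathfrak{g}_A\to\bigwedge\mathfrak{g}_A$ defined by $[a,b]=0$ and $[x,a]=-[a,x]=D_x(a)$ for scalars $a,b\in A$ and vectors $x\in\mathfrak{g}$,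 by $$[x_1\wedge\cdots\wedge x_n,y_1\wedge\cdots\wedge y_m]=\sum_{i,j}(-1)^{i+j}[x_i,y_j]\wedge x_1\wedge\cdots\wedge\widehat{x_i}\wedge\cdots\wedge x_n\wedge y_1\wedge\cdots\wedge\widehat{y_j}\wedge\cdots\wedge y_m$$ on simple tensors ($x_i,y_j\in\mathfrak{g}$, $n,m\ge1$, hats denote omission), and extended to all of $\bigwedge\mathfrak{g}_A$ by additivity. Between a scalar $a\in A$ and a simple tensor with $n\ge 1$ factors it reads $$[x_1\wedge\cdots\wedge x_n,a]=\sum_i(-1)^{n-i}D_{x_i}(a)\cdot x_1\wedge\cdots\wedge\widehat{x_i}\wedge\cdots\wedge x_n,\qquad [a,x_1\wedge\cdots\wedge x_n]=\sum_i(-1)^{i}D_{x_i}(a)\cdot x_1\wedge\cdots\wedge\widehat{x_i}\wedge\cdots\wedge x_n.$$ (This antisymmetric bracket on $\bigwedge\mathfrak{g}_A$ is to be distinguished from the graded symmetric bracket on $A\oplus\mathfrak{g}$.) Signs and shuffles: $e(x)=(-1)^{|x|}$ for homogeneous $x$. The Koszul sign $e(s)=e(s;x_1,\dots,x_k)\in\{\pm1\}$ of $s\in S_k$ is characterized by $x_1\otimes\cdots\otimes x_k=e(s;x_1,\dots,x_k)\,x_{s(1)}\otimes\cdots\otimes x_{s(k)}$ under the rule $x\otimes y=(-1)^{|x||y|}y\otimes x$. $Sh(p_1,\dots,p_r)$ is the set of $s\in S_{p_1+\cdots+p_r}$ that are increasing on each of the $r$ consecutive blocks of lengths $p_1,\dots,p_r$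 (blocks of length $0$ allowed). A $k$-linear map $F$ is graded symmetric if $F(x_1,\dots,x_k)=e(s;x_1,\dots,x_k)F(x_{s(1)},\dots,x_{s(k)})$ for all $s\in S_k$. The Lie $n$-bracket on $\bigwedge\mathfrak{g}_A$ is defined for $n\ge2$ and homogeneous $x_1,\dots,x_n$ by $$\{x_1,\ldots,x_n\}_n=\sum_{s\in Sh(2,n-2)}e(s;x_1,\ldots,x_n)\,e(x_{s(1)})\;x_{s(n)}\wedge\cdots\wedge x_{s(3)}\wedge[x_{s(2)},x_{s(1)}],$$ extended by additivity to all of $\bigwedge\mathfrak{g}_A$; the Lie $1$-bracket $\{\cdot\}_1$ is the zero operator. A Lie $\infty$-algebra $(V,(D_k)_{k\in\mathbb{N}})$ ($\mathbb{N}=\{1,2,\dots\}$) is a $\mathbb{Z}$-graded real vector space $V$ with graded symmetric $k$-multilinear maps $D_k$, homogeneous of degree $-1$, such that $\sum_{i+j=n+1}\sum_{s\in Sh(j,n-j)}e(s)D_i(D_j(v_{s(1)},\ldots,v_{s(j)}),v_{s(j+1)},\ldots,v_{s(n)})=0$ for all $n\in\mathbb{N}$ and homogeneous $v_1,\dots,v_n$. A morphism of Lie $\infty$-algebras $(V,(D_k)_k)\to(W,(l_k)_k)$ is a sequence $(f_k)_{k\in\mathbb{N}}$ of graded symmetric $k$-multilinear maps $f_k:V\times\cdots\times V\to W$, homogeneous of degree $0$, such that for all $n\in\mathbb{N}$ and homogeneous $v_1,\dots,v_n\in V$ $$\sum_{p+q=n+1}\ \sum_{s\in Sh(q,p-1)}e(s)f_p\left(D_q(v_{s(1)},\ldots,v_{s(q)}),v_{s(q+1)},\ldots,v_{s(n)}\right)=$$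 $$\sum_{p=1}^n\frac{1}{p!}\sum_{k_1+\cdots+k_p=n}\ \sum_{s\in Sh(k_1,\ldots,k_p)}e(s)\,l_p\left(f_{k_1}(v_{s(1)},\ldots,v_{s(k_1)}),\ldots,f_{k_p}(v_{s(n-k_p+1)},\ldots,v_{s(n)})\right),$$ where $p,q,k_1,\dots,k_p$ range over positive integers.
   Formalization: The anchor D is also assumed A-linear (D_{a·x} = a·D_x), as is standard for Lie Rinehart pairs; without it the Schouten-Nijenhuis bracket may be ill-defined, and the claim fails for A = R[t], g = Rx, a·x = a(0)x, D_x = t d/dt at (t,t,x). *)

(* Defs.v *)
From HB Require Import structures.
From mathcomp Require Import all_boot all_order all_fingroup all_algebra.
From mathcomp Require Import boolp reals.

Set Implicit Arguments.
Unset Strict Implicit.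
Unset Printing Implicit Defensive.

Import GRing.Theory.
Local Open Scope ring_scope.
Local Open Scope quotient_scope.

Section ExteriorAlgebra.
Variables (A : comNzRingType) (g : lmodType A).

(* The list [:: (a1, w1); ...; (ak, wk)] stands for the formal sum of the
   a_l . x_1 /\ ... /\ x_n, where w_l = [:: x_1; ...; x_n]. *)
Definition pre_ext := seq (A * seq g).

Inductive ext_rel : pre_ext -> pre_ext -> Prop :=
| ext_refl p : ext_rel p p
| ext_sym p q : ext_rel p q -> ext_rel q p
| ext_trans p q r : ext_rel p q -> ext_rel q r -> ext_rel p r
| ext_cat p p' q q' :
    ext_rel p p' -> ext_rel q q' -> ext_rel (p ++ q) (p' ++ q')
| ext_catC p q : ext_rel (p ++ q) (q ++ p)
| ext_coef0 w : ext_rel [:: (0, w)] [::]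
| ext_coefD a b w : ext_rel [:: (a + b, w)] [:: (a, w); (b, w)]
| ext_vecD a u x y v :
    ext_rel [:: (a, u ++ (x + y) :: v)] [:: (a, u ++ x :: v); (a, u ++ y :: v)]
| ext_vecZ a b u x v :
    ext_rel [:: (a, u ++ (b *: x) :: v)] [:: (a * b, u ++ x :: v)]
| ext_alt a u x v : ext_rel [:: (a, u ++ x :: x :: v)] [::].

Definition ext_relb (p q : pre_ext) : bool := `[< ext_rel p q >].

Lemma ext_relb_refl : reflexive ext_relb.
Proof. by move=> p; apply/asboolP; exact: ext_refl. Qed.
Lemma ext_relb_sym : symmetric ext_relb.
Proof. by move=> p q; apply/asboolP/asboolP; exact: ext_sym. Qed.
Lemma ext_relb_trans : transitive ext_relb.
Proof.
by move=> q p r /asboolP pq /asboolP qr; apply/asboolP; exact: ext_trans qr.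
Qed.
Canonical ext_equiv := EquivRel ext_relb ext_relb_refl ext_relb_sym ext_relb_trans.

Definition ext : Type := {eq_quot ext_equiv}.
HB.instance Definition _ := Choice.copy ext {eq_quot ext_equiv}.

Definition ext_pi (p : pre_ext) : ext := \pi_{eq_quot ext_equiv} p.
Definition ext_repr (x : ext) : pre_ext := generic_quotient.repr (x : {eq_quot ext_equiv}).

Lemma ext_reprK x : ext_pi (ext_repr x) = x.
Proof. exact: (@generic_quotient.reprK _ {eq_quot ext_equiv}). Qed.

Lemma ext_piP p q : ext_pi p = ext_pi q <-> ext_rel p q.
Proof.
split=> [h|h]; last by apply/(@eqmodP _ ext_equiv); apply/asboolP.
by apply/asboolP; apply/(@eqmodP _ ext_equiv).
Qed.

Lemma ext_repr_pi p : ext_rel (ext_repr (ext_pi p)) p.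
Proof. by apply/ext_piP; rewrite ext_reprK. Qed.

Lemma ext_pind (P : ext -> Prop) : (forall p, P (ext_pi p)) -> forall x, P x.
Proof. by move=> h x; rewrite -(ext_reprK x). Qed.

Definition ext_oppp (p : pre_ext) : pre_ext := [seq (- t.1, t.2) | t <- p].

Definition ext_add (x y : ext) : ext := ext_pi (ext_repr x ++ ext_repr y).
Definition ext_opp (x : ext) : ext := ext_pi (ext_oppp (ext_repr x)).

Lemma ext_add_pi p q : ext_add (ext_pi p) (ext_pi q) = ext_pi (p ++ q).
Proof. by apply/ext_piP; apply: ext_cat; exact: ext_repr_pi. Qed.

Lemma ext_oppp_cancel p : ext_rel (ext_oppp p ++ p) [::].
Proof.
elim: p => [|[a w] p ih] /=; first exact: ext_refl.
apply: (@ext_trans _ ([:: (- a, w)] ++ (p ++ [:: (a, w)]) ++ ext_oppp p)).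
  apply: (@ext_cat [:: (-a, w)] [:: (-a, w)]); first exact: ext_refl.
  apply: (@ext_trans _ ((((a, w) :: p)) ++ ext_oppp p)); first exact: ext_catC.
  apply: ext_cat; last exact: ext_refl.
  exact: (@ext_catC [:: (a, w)] p).
apply: (@ext_trans _ ([:: (- a, w)] ++ [:: (a, w)] ++ (p ++ ext_oppp p))).
  apply: (@ext_cat [:: (-a, w)] [:: (-a, w)]); first exact: ext_refl.
  rewrite catA; apply: ext_cat; last exact: ext_refl.
  exact: (@ext_catC p [:: (a, w)]).
apply: (@ext_trans _ ([::] ++ [::])); last exact: ext_refl.
rewrite (catA [:: (- a, w)]); apply: ext_cat.
  apply: (@ext_trans _ [:: (- a + a, w)]); first by rewrite /=; apply: ext_sym; apply: ext_coefD.
  rewrite addNr; exact: ext_coef0.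
apply: ext_trans ih; exact: ext_catC.
Qed.

Lemma ext_addA : associative ext_add.
Proof.
elim/ext_pind=> p; elim/ext_pind=> q; elim/ext_pind=> r.
by rewrite !ext_add_pi catA.
Qed.
Lemma ext_addC : commutative ext_add.
Proof.
elim/ext_pind=> p; elim/ext_pind=> q; rewrite !ext_add_pi.
by apply/ext_piP; exact: ext_catC.
Qed.
Lemma ext_add0 : left_id (ext_pi [::]) ext_add.
Proof. by elim/ext_pind=> p; rewrite ext_add_pi. Qed.
Lemma ext_addN : left_inverse (ext_pi [::]) ext_opp ext_add.
Proof.
elim/ext_pind=> p; rewrite /ext_opp -{2}(ext_reprK (ext_pi p)) ext_add_pi.
by apply/ext_piP; exact: ext_oppp_cancel.
Qed.

HB.instance Definition _ :=
  GRing.isZmodule.Build ext ext_addA ext_addC ext_add0 ext_addN.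

Lemma ext_piD p q : ext_pi (p ++ q) = ext_pi p + ext_pi q.
Proof. by rewrite -ext_add_pi. Qed.

Definition ext_term (a : A) (w : seq g) : ext := ext_pi [:: (a, w)].

Lemma ext_pi_sum p : ext_pi p = \sum_(t <- p) ext_term t.1 t.2.
Proof.
elim: p => [|[a w] p ih]; first by rewrite big_nil.
by rewrite big_cons -ih -ext_piD.
Qed.

Lemma ext_ind (P : ext -> Prop) :
  P 0 -> (forall a w x, P x -> P (ext_term a w + x)) -> forall x, P x.
Proof.
move=> h0 hS; elim/ext_pind=> p; rewrite ext_pi_sum.
by elim: p => [|[a w] p ih]; rewrite ?big_nil ?big_cons //; apply: hS.
Qed.

(* The additive maps out of the exterior algebra: A-balanced, alternating,
   multiadditive functions on simple tensors. *)
Record ext_form (M : zmodType) (phi : A -> seq g -> M) : Prop := ExtForm {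
  ext_formD : forall a b w, phi (a + b) w = phi a w + phi b w;
  ext_formxD : forall a u x y v,
    phi a (u ++ (x + y) :: v) = phi a (u ++ x :: v) + phi a (u ++ y :: v);
  ext_formxZ : forall a b u x v,
    phi a (u ++ (b *: x) :: v) = phi (a * b) (u ++ x :: v);
  ext_form_alt : forall a u x v, phi a (u ++ x :: x :: v) = 0 }.

(* Locked, so that unification does not unfold products into sums. *)
Fact ext_lift_key : unit. Proof. exact: tt. Qed.
Definition ext_lift (M : zmodType) (phi : A -> seq g -> M) (x : ext) : M :=
  locked_with ext_lift_key (\sum_(t <- ext_repr x) phi t.1 t.2).

Section Lift.
Variables (M : zmodType) (phi : A -> seq g -> M).
Hypothesis phiP : ext_form phi.

Lemma ext_lift_pi p : ext_lift phi (ext_pi p) = \sum_(t <- p) phi t.1 t.2.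
Proof.
have phi0 w : phi 0 w = 0.
  by apply: (addrI (phi 0 w)); rewrite -(ext_formD phiP) !addr0.
rewrite /ext_lift unlock; have := ext_repr_pi p; move: (ext_repr _) => q.
elim=> {p q} //=.
- by move=> p q r _ -> _ ->.
- by move=> p p' q q' _ hp _ hq; rewrite !big_cat /= hp hq.
- by move=> p q; rewrite !big_cat /= addrC.
- by move=> w; rewrite big_seq1 big_nil.
- by move=> a b w; rewrite !(big_cons, big_nil) /= (ext_formD phiP) !addr0.
- by move=> a u x y v; rewrite !(big_cons, big_nil) /= (ext_formxD phiP) !addr0.
- by move=> a b u x v; rewrite !big_seq1 /= (ext_formxZ phiP).
- by move=> a u x v; rewrite big_seq1 big_nil /= (ext_form_alt phiP).
Qed.

Lemma ext_lift_term a w : ext_lift phi (ext_term a w) = phi a w.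
Proof. by rewrite ext_lift_pi big_seq1. Qed.

Lemma ext_liftD x y : ext_lift phi (x + y) = ext_lift phi x + ext_lift phi y.
Proof.
elim/ext_pind: x => p; elim/ext_pind: y => q.
by rewrite -ext_piD !ext_lift_pi big_cat.
Qed.

Lemma ext_lift0 : ext_lift phi 0 = 0.
Proof. by apply: (addrI (ext_lift phi 0)); rewrite -ext_liftD !addr0. Qed.

End Lift.

Lemma ext_term_form : ext_form ext_term.
Proof.
split.
- by move=> a b w; rewrite -ext_piD; apply/ext_piP; exact: ext_coefD.
- by move=> a u x y v; rewrite -ext_piD; apply/ext_piP; exact: ext_vecD.
- by move=> a b u x v; apply/ext_piP; exact: ext_vecZ.
- by move=> a u x v; apply/ext_piP; exact: ext_alt.
Qed.

Lemma ext_scale_form c : ext_form (fun a w => ext_term (c * a) w).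
Proof.
have H := ext_term_form; split.
- by move=> a b w; rewrite mulrDr (ext_formD H).
- by move=> *; rewrite (ext_formxD H).
- by move=> *; rewrite (ext_formxZ H) mulrA.
- by move=> *; rewrite (ext_form_alt H).
Qed.

Definition ext_scale (c : A) : ext -> ext :=
  ext_lift (fun a w => ext_term (c * a) w).

Lemma ext_scale_term c a w : ext_scale c (ext_term a w) = ext_term (c * a) w.
Proof. exact: (ext_lift_term (ext_scale_form c)). Qed.
Lemma ext_scaleDr c x y : ext_scale c (x + y) = ext_scale c x + ext_scale c y.
Proof. exact: (ext_liftD (ext_scale_form c)). Qed.
Lemma ext_scaler0 c : ext_scale c 0 = 0.
Proof. exact: (ext_lift0 (ext_scale_form c)). Qed.

Lemma ext_scaleA a b x : ext_scale a (ext_scale b x) = ext_scale (a * b) x.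
Proof.
elim/ext_ind: x => [|c w x ih]; first by rewrite !ext_scaler0.
by rewrite !ext_scaleDr ih !ext_scale_term mulrA.
Qed.
Lemma ext_scale1 : left_id 1 ext_scale.
Proof.
elim/ext_ind=> [|c w x ih]; first by rewrite ext_scaler0.
by rewrite ext_scaleDr ih ext_scale_term mul1r.
Qed.
Lemma ext_scale_addr : right_distributive ext_scale +%R.
Proof. exact: ext_scaleDr. Qed.
Lemma ext_scaleDl x : {morph ext_scale^~ x : a b / a + b}.
Proof.
move=> a b; elim/ext_ind: x => [|c w x ih]; first by rewrite !ext_scaler0 addr0.
rewrite !ext_scaleDr ih !ext_scale_term mulrDl (ext_formD ext_term_form).
by rewrite addrACA.
Qed.

HB.instance Definition _ := GRing.Zmodule_isLmodule.Build A ext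
  ext_scaleA ext_scale1 ext_scale_addr ext_scaleDl.

Lemma ext_mulr_form a u : ext_form (fun b v => ext_term (a * b) (u ++ v)).
Proof.
have H := ext_term_form; split.
- by move=> b c w; rewrite mulrDr (ext_formD H).
- by move=> *; rewrite !catA (ext_formxD H).
- by move=> *; rewrite !catA (ext_formxZ H) mulrA.
- by move=> *; rewrite !catA (ext_form_alt H).
Qed.

Lemma ext_mull_form y :
  ext_form (fun a u => ext_lift (fun b v => ext_term (a * b) (u ++ v)) y).
Proof.
have H := ext_term_form; split.
- move=> a b u; elim/ext_ind: y => [|c w y ih].
    by rewrite !(ext_lift0 (ext_mulr_form _ _)) addr0.
  rewrite !(ext_liftD (ext_mulr_form _ _)) ih.
  by rewrite !(ext_lift_term (ext_mulr_form _ _)) mulrDl (ext_formD H) addrACA.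
- move=> a u x x' v; elim/ext_ind: y => [|c w y ih].
    by rewrite !(ext_lift0 (ext_mulr_form _ _)) addr0.
  rewrite !(ext_liftD (ext_mulr_form _ _)) ih.
  rewrite !(ext_lift_term (ext_mulr_form _ _)) -!catA /= (ext_formxD H).
  by rewrite addrACA.
- move=> a b u x v; elim/ext_ind: y => [|c w y ih].
    by rewrite !(ext_lift0 (ext_mulr_form _ _)).
  rewrite !(ext_liftD (ext_mulr_form _ _)) ih.
  by rewrite !(ext_lift_term (ext_mulr_form _ _)) -!catA /= (ext_formxZ H) mulrAC.
- move=> a u x v; elim/ext_ind: y => [|c w y ih].
    by rewrite !(ext_lift0 (ext_mulr_form _ _)).
  rewrite !(ext_liftD (ext_mulr_form _ _)) ih addr0.
  by rewrite !(ext_lift_term (ext_mulr_form _ _)) -!catA /= (ext_form_alt H).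
Qed.

(* The wedge product. *)
Definition ext_mul (x y : ext) : ext :=
  ext_lift (fun a u => ext_lift (fun b v => ext_term (a * b) (u ++ v)) y) x.

Lemma ext_mul_term a u b v :
  ext_mul (ext_term a u) (ext_term b v) = ext_term (a * b) (u ++ v).
Proof.
by rewrite /ext_mul (ext_lift_term (ext_mull_form _)) (ext_lift_term (ext_mulr_form _ _)).
Qed.
Lemma ext_mulDl : left_distributive ext_mul +%R.
Proof. by move=> x y z; exact: (ext_liftD (ext_mull_form _)). Qed.
Lemma ext_mul0 z : ext_mul 0 z = 0.
Proof. exact: (ext_lift0 (ext_mull_form _)). Qed.
Lemma ext_mulDr : right_distributive ext_mul +%R.
Proof.
move=> x y z; elim/ext_ind: x => [|a u x ih]; first by rewrite !ext_mul0 addr0.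
rewrite !ext_mulDl ih addrACA; congr (_ + _).
by rewrite /ext_mul !(ext_lift_term (ext_mull_form _)) (ext_liftD (ext_mulr_form _ _)).
Qed.
Lemma ext_mulr0 z : ext_mul z 0 = 0.
Proof. by apply: (addrI (ext_mul z 0)); rewrite -ext_mulDr !addr0. Qed.
Lemma ext_mulA : associative ext_mul.
Proof.
elim/ext_ind=> [|a u x ihx] y z; first by rewrite !ext_mul0.
rewrite !ext_mulDl ihx; congr (_ + _).
elim/ext_ind: y => [|b v y ihy]; first by rewrite !(ext_mul0, ext_mulr0).
rewrite !(ext_mulDl, ext_mulDr) ihy; congr (_ + _).
elim/ext_ind: z {ihy} => [|c w z ihz]; first by rewrite !ext_mulr0.
by rewrite !ext_mulDr ihz; congr (_ + _); rewrite !ext_mul_term mulrA catA.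
Qed.
Lemma ext_mul1 : left_id (ext_term 1 [::]) ext_mul.
Proof.
elim/ext_ind=> [|a u x ih]; first by rewrite ext_mulr0.
by rewrite ext_mulDr ih ext_mul_term mul1r.
Qed.
Lemma ext_mulr1 : right_id (ext_term 1 [::]) ext_mul.
Proof.
elim/ext_ind=> [|a u x ih]; first by rewrite ext_mul0.
by rewrite ext_mulDl ih ext_mul_term mulr1 cats0.
Qed.

HB.instance Definition _ := GRing.Zmodule_isPzRing.Build ext
  ext_mulA ext_mul1 ext_mulr1 ext_mulDl ext_mulDr.

Lemma ext_scaleAl (a : A) (x y : ext) : a *: (x * y) = a *: x * y.
Proof.
change (ext_scale a (ext_mul x y) = ext_mul (ext_scale a x) y).
elim/ext_ind: x => [|b u x ih]; first by rewrite ext_scaler0 ext_mul0 ext_scaler0.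
rewrite ext_mulDl !ext_scaleDr ext_mulDl ih; congr (_ + _).
elim/ext_ind: y {ih} => [|c v y ih]; first by rewrite !ext_mulr0 ext_scaler0.
by rewrite !ext_mulDr ext_scaleDr ih !(ext_scale_term, ext_mul_term) mulrA.
Qed.

Lemma ext_scaleAr (a : A) (x y : ext) : a *: (x * y) = x * (a *: y).
Proof.
change (ext_scale a (ext_mul x y) = ext_mul x (ext_scale a y)).
elim/ext_ind: x => [|b u x ih]; first by rewrite !ext_mul0 ext_scaler0.
rewrite !ext_mulDl !ext_scaleDr ih; congr (_ + _).
elim/ext_ind: y {ih} => [|c v y ih]; first by rewrite ext_scaler0 !ext_mulr0 ext_scaler0.
by rewrite ext_mulDr !ext_scaleDr ext_mulDr ih !(ext_scale_term, ext_mul_term) mulrCA.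
Qed.

Definition ext_vec (x : g) : ext := ext_term 1 [:: x].

(* x_1 /\ ... /\ x_n *)
Definition ext_wedge (w : seq g) : ext := \prod_(x <- w) ext_vec x.

Lemma ext_wedgeE w : ext_wedge w = ext_term 1 w.
Proof.
rewrite /ext_wedge; elim: w => [|x w ih]; first by rewrite big_nil.
by rewrite big_cons ih [LHS]ext_mul_term mul1r.
Qed.

Lemma ext_termE a w : ext_term a w = a *: ext_wedge w.
Proof. by rewrite ext_wedgeE [RHS]ext_scale_term mulr1. Qed.

(* The n-th exterior power, inside the exterior algebra. *)
Definition ext_power (n : nat) (x : ext) : Prop :=
  exists r : seq (A * n.-tuple g), x = \sum_(t <- r) t.1 *: ext_wedge t.2.

End ExteriorAlgebra.

Section ExteriorTheory.
Variables (A : comNzRingType) (g : lmodType A).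
Local Notation E := (ext g).
Local Notation W := (@ext_wedge A g).
Local Notation "'io'" := (@ext_vec A g).

Lemma ext_wedge_nil : W [::] = 1.
Proof. by rewrite /ext_wedge big_nil. Qed.
Lemma ext_wedge_cons x w : W (x :: w) = io x * W w.
Proof. by rewrite /ext_wedge big_cons. Qed.
Lemma ext_wedge_cat u v : W (u ++ v) = W u * W v.
Proof. by rewrite /ext_wedge big_cat. Qed.
Lemma ext_wedge1 x : W [:: x] = io x.
Proof. by rewrite ext_wedge_cons ext_wedge_nil mulr1. Qed.

Lemma ext_vecDE x y : io (x + y) = io x + io y.
Proof. exact: (ext_formxD (ext_term_form g) 1 [::] x y [::]). Qed.
Lemma ext_vecZE a x : io (a *: x) = a *: io x.
Proof.
rewrite /ext_vec (ext_formxZ (ext_term_form g) 1 a [::] x [::]).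
by rewrite mul1r ext_termE ext_wedge1.
Qed.
Lemma ext_vec_sqr x : io x * io x = 0.
Proof.
rewrite -!ext_wedge1 -ext_wedge_cat ext_wedgeE.
exact: (ext_form_alt (ext_term_form g) 1 [::] x [::]).
Qed.
Lemma ext_vecC x y : io x * io y = - (io y * io x).
Proof.
apply/eqP; rewrite -addr_eq0; apply/eqP.
have := ext_vec_sqr (x + y).
by rewrite ext_vecDE mulrDl !mulrDr !ext_vec_sqr add0r addr0.
Qed.

Lemma ext_signC (n : nat) (x y : E) : x * ((-1) ^+ n * y) = (-1) ^+ n * (x * y).
Proof. by rewrite !mulrA; congr (_ * _); apply/commr_sign. Qed.

Lemma ext_wedge_vecC w x : W w * io x = (-1) ^+ size w * (io x * W w).
Proof.
elim: w => [|y w ih]; first by rewrite ext_wedge_nil mulr1 !mul1r.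
rewrite ext_wedge_cons -mulrA ih ext_signC /= exprS mulN1r mulNr -mulrN.
by congr (_ * _); rewrite !mulrA (ext_vecC y x) mulNr.
Qed.

Lemma ext_wedge_alt u x v : W (u ++ x :: x :: v) = 0.
Proof. by rewrite ext_wedge_cat !ext_wedge_cons (mulrA (io x)) ext_vec_sqr mul0r mulr0. Qed.
Lemma ext_wedgeD u x y v : W (u ++ (x + y) :: v) = W (u ++ x :: v) + W (u ++ y :: v).
Proof. by rewrite !ext_wedge_cat !ext_wedge_cons ext_vecDE mulrDl mulrDr. Qed.
Lemma ext_wedgeZ u b x v : W (u ++ (b *: x) :: v) = b *: W (u ++ x :: v).
Proof.
by rewrite !ext_wedge_cat !ext_wedge_cons ext_vecZE -ext_scaleAl -ext_scaleAr.
Qed.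

Lemma ext_span (P : E -> Prop) :
  P 0 -> (forall a w x, P x -> P (a *: W w + x)) -> forall x, P x.
Proof. by move=> h0 hS; apply: ext_ind => // a w x Px; rewrite ext_termE; apply: hS. Qed.

Lemma ext_lift_scale (M : zmodType) (phi : A -> seq g -> M) a w :
  ext_form phi -> ext_lift phi (a *: W w) = phi a w.
Proof. by move=> h; rewrite -ext_termE ext_lift_term. Qed.

(* Projection to the sum of the homogeneous components of degrees in P. *)
Definition ext_proj (P : pred nat) : E -> E :=
  ext_lift (fun a w => if P (size w) then a *: W w else 0).

Lemma ext_proj_form P :
  ext_form (fun a (w : seq g) => if P (size w) then a *: W w else 0).
Proof.
split=> [a b w|a u x y v|a b u x v|a u x v]; rewrite ?size_cat /=; case: ifP => _;
  rewrite ?addr0 ?scalerDl ?ext_wedgeD ?scalerDr ?ext_wedgeZ ?scalerA //.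
by rewrite ext_wedge_alt scaler0.
Qed.

Lemma ext_projW P a w :
  ext_proj P (a *: W w) = if P (size w) then a *: W w else 0.
Proof. exact: ext_lift_scale (ext_proj_form P). Qed.
Lemma ext_projD P x y : ext_proj P (x + y) = ext_proj P x + ext_proj P y.
Proof. exact: (ext_liftD (ext_proj_form P)). Qed.
Lemma ext_proj0 P : ext_proj P 0 = 0.
Proof. exact: (ext_lift0 (ext_proj_form P)). Qed.
Lemma ext_proj_sum P I (r : seq I) (F : I -> E) :
  ext_proj P (\sum_(i <- r) F i) = \sum_(i <- r) ext_proj P (F i).
Proof. by apply: (big_morph _ (ext_projD P) (ext_proj0 P)). Qed.

Lemma ext_proj_power P n x : ext_power n x -> ext_proj P x = if P n then x else 0.
Proof.
case=> r ->; rewrite ext_proj_sum.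
under eq_bigr do rewrite ext_projW size_tuple.
by case: (P n); rewrite // big1.
Qed.

Lemma ext_power0 n : ext_power n (0 : E).
Proof. by exists [::]; rewrite big_nil. Qed.
Lemma ext_powerD n (x y : E) : ext_power n x -> ext_power n y -> ext_power n (x + y).
Proof. by move=> [r ->] [s ->]; exists (r ++ s); rewrite big_cat. Qed.
Lemma ext_powerZ n a (x : E) : ext_power n x -> ext_power n (a *: x).
Proof.
move=> [r ->]; exists [seq (a * t.1, t.2) | t <- r].
by rewrite big_map scaler_sumr; apply: eq_bigr => t _; rewrite scalerA.
Qed.
Lemma ext_power_wedge w : ext_power (size w) (W w).
Proof. by exists [:: (1, in_tuple w)]; rewrite big_seq1 scale1r. Qed.

End ExteriorTheory.

(* The real vector space structure of g is the one induced by its A-module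
   structure: k . x = (k 1_A) . x.  The A-linearity lr_anchorZ of the anchor
   is needed for the Schouten-Nijenhuis bracket to be well defined. *)
Record LieRinehart (R : realType) (A : comAlgType R) (g : lmodType A) := {
  lr_bracket : g -> g -> g;
  lr_anchor : g -> A -> A;
  lr_bracketPl : forall (k : R) x y z,
    lr_bracket (k%:A *: x + y) z = k%:A *: lr_bracket x z + lr_bracket y z;
  lr_bracketPr : forall (k : R) x y z,
    lr_bracket x (k%:A *: y + z) = k%:A *: lr_bracket x y + lr_bracket x z;
  lr_bracketxx : forall x, lr_bracket x x = 0;
  lr_jacobi : forall x y z,
    lr_bracket x (lr_bracket y z) + lr_bracket y (lr_bracket z x)
      + lr_bracket z (lr_bracket x y) = 0;
  lr_anchor_linear : forall x (k : R) a b,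
    lr_anchor x (k *: a + b) = k *: lr_anchor x a + lr_anchor x b;
  lr_anchorM : forall x a b,
    lr_anchor x (a * b) = lr_anchor x a * b + a * lr_anchor x b;
  lr_anchorD : forall x y a, lr_anchor (x + y) a = lr_anchor x a + lr_anchor y a;
  lr_anchorZ : forall a x b, lr_anchor (a *: x) b = a * lr_anchor x b;
  lr_anchor_bracket : forall x y a,
    lr_anchor (lr_bracket x y) a
      = lr_anchor x (lr_anchor y a) - lr_anchor y (lr_anchor x a);
  lr_leibniz : forall x a y,
    lr_bracket x (a *: y) = lr_anchor x a *: y + a *: lr_bracket x y }.

Definition delete_nth (T : Type) (i : nat) (s : seq T) : seq T :=
  take i s ++ drop i.+1 s.
Arguments delete_nth : simpl never.

Lemma delete_nth0 (T : Type) (x : T) s : delete_nth 0 (x :: s) = s.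
Proof. by rewrite /delete_nth take0 /= drop0. Qed.
Lemma delete_nthS (T : Type) i (x : T) s :
  delete_nth i.+1 (x :: s) = x :: delete_nth i s.
Proof. by []. Qed.

Section Schouten.
Variables (R : realType) (A : comAlgType R) (g : lmodType A) (L : LieRinehart g).
Local Notation E := (ext g).
Local Notation W := (@ext_wedge A g).
Local Notation "'io'" := (@ext_vec A g).
Local Notation D := (lr_anchor L).
Local Notation br := (lr_bracket L).

(* Indices start at 0, hence the shifts in the signs of the scalar cases. *)
Record is_schouten (S : E -> E -> E) : Prop := IsSchouten {
  schoutenDl : forall p q r, S (p + q) r = S p r + S q r;
  schoutenDr : forall p q r, S p (q + r) = S p q + S p r;
  schouten_scalars : forall a b : A, S (a *: (1 : E)) (b *: (1 : E)) = 0;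
  schouten_vec_scalar : forall (x : g) (a : A), S (io x) (a *: (1 : E)) = D x a *: (1 : E);
  schouten_scalar_vec : forall (x : g) (a : A), S (a *: (1 : E)) (io x) = - (D x a *: (1 : E));
  schouten_wedge_scalar : forall (xs : seq g) (a : A), (0 < size xs)%N ->
    S (W xs) (a *: (1 : E)) =
    \sum_(i < size xs)
       (-1) ^+ (size xs - i.+1) * (D xs`_i a *: W (delete_nth i xs));
  schouten_scalar_wedge : forall (a : A) (xs : seq g), (0 < size xs)%N ->
    S (a *: (1 : E)) (W xs) =
    \sum_(i < size xs) (-1) ^+ i.+1 * (D xs`_i a *: W (delete_nth i xs));
  schouten_wedge : forall xs ys : seq g, (0 < size xs)%N -> (0 < size ys)%N ->
    S (W xs) (W ys) =
    \sum_(i < size xs) \sum_(j < size ys)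
       (-1) ^+ (i + j) * W (br xs`_i ys`_j :: delete_nth i xs ++ delete_nth j ys) }.

Lemma lr_anchorDr x a b : D x (a + b) = D x a + D x b.
Proof. by rewrite -[a in LHS]scale1r lr_anchor_linear scale1r. Qed.
Lemma lr_anchor0 x : D x 0 = 0.
Proof. by apply: (addrI (D x 0)); rewrite -lr_anchorDr !addr0. Qed.
Lemma lr_anchor1 x : D x 1 = 0.
Proof.
apply: (addrI (D x 1)); rewrite addr0 -{3}(mulr1 (1 : A)) lr_anchorM.
by rewrite mulr1 mul1r.
Qed.
Lemma lr_bracketDl x y z : br (x + y) z = br x z + br y z.
Proof. by have := lr_bracketPl L 1 x y z; rewrite !scale1r. Qed.
Lemma lr_bracketDr x y z : br x (y + z) = br x y + br x z.
Proof. by have := lr_bracketPr L 1 x y z; rewrite !scale1r. Qed.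
Lemma lr_bracketC x y : br x y = - br y x.
Proof.
apply/eqP; rewrite -addr_eq0; apply/eqP.
have := lr_bracketxx L (x + y).
by rewrite lr_bracketDl !lr_bracketDr !lr_bracketxx add0r addr0.
Qed.
Lemma lr_leibnizl x b y : br (b *: x) y = b *: br x y - D y b *: x.
Proof. by rewrite lr_bracketC lr_leibniz opprD addrC (lr_bracketC y) scalerN opprK. Qed.

(* [a, .] *)
Fixpoint ctr (a : A) (w : seq g) : E :=
  if w is y :: v then - (D y a *: W v) - io y * ctr a v else 0.

Lemma ctrD a b w : ctr (a + b) w = ctr a w + ctr b w.
Proof.
elim: w => [|y v ih] /=; first by rewrite addr0.
by rewrite ih lr_anchorDr scalerDl mulrDr !opprD addrACA.
Qed.
Lemma ctrM a b w : ctr (a * b) w = a *: ctr b w + b *: ctr a w.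
Proof.
elim: w => [|y v ih] /=; first by rewrite !scaler0 addr0.
rewrite ih lr_anchorM !scalerBr !scalerN !scalerA mulrDr !ext_scaleAr !scalerDl.
by rewrite (mulrC _ b) [X in - X - _]addrC !opprD addrACA.
Qed.
Lemma ctrvD a u x y v : ctr a (u ++ (x + y) :: v) = ctr a (u ++ x :: v) + ctr a (u ++ y :: v).
Proof.
elim: u => [|z u ih] /=.
  by rewrite lr_anchorD ext_vecDE scalerDl mulrDl !opprD addrACA.
by rewrite ih ext_wedgeD scalerDr mulrDr !opprD addrACA.
Qed.
Lemma ctrvZ a u b x v : ctr a (u ++ (b *: x) :: v) = b *: ctr a (u ++ x :: v).
Proof.
elim: u => [|z u ih] /=.
  by rewrite lr_anchorZ ext_vecZE -ext_scaleAl scalerBr scalerN scalerA.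
by rewrite ih ext_wedgeZ -ext_scaleAr scalerBr scalerN !scalerA mulrC.
Qed.
Lemma ctr_alt a u x v : ctr a (u ++ x :: x :: v) = 0.
Proof.
elim: u => [|z u ih] /=; last by rewrite ih ext_wedge_alt mulr0 scaler0 subr0 oppr0.
rewrite ext_wedge_cons mulrDr !mulrN (mulrA (io x)) ext_vec_sqr mul0r.
by rewrite subr0 opprK ext_scaleAr addNr.
Qed.

Lemma ctr_form a : ext_form (fun b w => b *: ctr a w).
Proof.
split.
- by move=> b c w; rewrite scalerDl.
- by move=> *; rewrite ctrvD scalerDr.
- by move=> *; rewrite ctrvZ scalerA.
- by move=> *; rewrite ctr_alt scaler0.
Qed.

Definition ctrE a : E -> E := ext_lift (fun b w => b *: ctr a w).
Lemma ctrEW a b w : ctrE a (b *: W w) = b *: ctr a w.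
Proof. exact: ext_lift_scale (ctr_form a). Qed.
Lemma ctrED a x y : ctrE a (x + y) = ctrE a x + ctrE a y.
Proof. exact: (ext_liftD (ctr_form a)). Qed.
Lemma ctrE0 a : ctrE a 0 = 0.
Proof. exact: (ext_lift0 (ctr_form a)). Qed.
Lemma ctrEDl a b Q : ctrE (a + b) Q = ctrE a Q + ctrE b Q.
Proof.
elim/ext_span: Q => [|c w Q ih]; first by rewrite !ctrE0 addr0.
by rewrite !ctrED ih !ctrEW ctrD scalerDr addrACA.
Qed.
Lemma ctrEM a b Q : ctrE (a * b) Q = a *: ctrE b Q + b *: ctrE a Q.
Proof.
elim/ext_span: Q => [|c w Q ih]; first by rewrite !ctrE0 !scaler0 addr0.
rewrite !ctrED ih !ctrEW ctrM !scalerDr !scalerA addrACA.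
by rewrite (mulrC c a) (mulrC c b).
Qed.

(* [x, .] *)
Fixpoint liew (x : g) (w : seq g) : E :=
  if w is y :: v then io (br x y) * W v + io y * liew x v else 0.

Lemma liewDl x x' w : liew (x + x') w = liew x w + liew x' w.
Proof.
elim: w => [|y v ih] /=; first by rewrite addr0.
by rewrite ih lr_bracketDl ext_vecDE mulrDl mulrDr addrACA.
Qed.
Lemma liewZl b x w : liew (b *: x) w = b *: liew x w + io x * ctr b w.
Proof.
elim: w => [|y v ih] /=; first by rewrite mulr0 scaler0 addr0.
rewrite ih lr_leibnizl -scaleNr ext_vecDE !ext_vecZE mulrDl mulrDr -!ext_scaleAl.
rewrite scalerDr -ext_scaleAr addrACA; congr (_ + _).
by rewrite mulrBr mulrN scaleNr -ext_scaleAr !mulrA (ext_vecC y x) mulNr.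
Qed.
Lemma liewD x u y z v : liew x (u ++ (y + z) :: v) = liew x (u ++ y :: v) + liew x (u ++ z :: v).
Proof.
elim: u => [|t u ih] /=.
  by rewrite lr_bracketDr !ext_vecDE !mulrDl addrACA.
by rewrite ih ext_wedgeD !mulrDr addrACA.
Qed.
Lemma liewZ x u b y v :
  liew x (u ++ (b *: y) :: v) = D x b *: W (u ++ y :: v) + b *: liew x (u ++ y :: v).
Proof.
elim: u => [|t u ih] /=.
  rewrite lr_leibniz ext_vecDE !ext_vecZE mulrDl -!ext_scaleAl -addrA -scalerDr.
  by rewrite ext_wedge_cons.
by rewrite ih ext_wedgeZ ext_wedge_cons mulrDr -!ext_scaleAr scalerDr addrCA.
Qed.
Lemma liew_alt x u y v : liew x (u ++ y :: y :: v) = 0.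
Proof.
elim: u => [|t u ih] /=; last by rewrite ih ext_wedge_alt !mulr0 addr0.
rewrite ext_wedge_cons mulrDr !mulrA ext_vec_sqr mul0r addr0.
by rewrite (ext_vecC y) mulNr addrN.
Qed.

Lemma lie_form x : ext_form (fun b w => D x b *: W w + b *: liew x w).
Proof.
split.
- by move=> b c w; rewrite lr_anchorDr !scalerDl addrACA.
- by move=> *; rewrite ext_wedgeD liewD !scalerDr addrACA.
- move=> a b u y v; rewrite ext_wedgeZ liewZ lr_anchorM scalerDr !scalerA.
  by rewrite addrA -scalerDl.
- by move=> *; rewrite ext_wedge_alt liew_alt !scaler0 addr0.
Qed.

Definition lieE x : E -> E := ext_lift (fun b w => D x b *: W w + b *: liew x w).
Lemma lieEW x b w : lieE x (b *: W w) = D x b *: W w + b *: liew x w.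
Proof. exact: ext_lift_scale (lie_form x). Qed.
Lemma lieED x p q : lieE x (p + q) = lieE x p + lieE x q.
Proof. exact: (ext_liftD (lie_form x)). Qed.
Lemma lieE0 x : lieE x 0 = 0.
Proof. exact: (ext_lift0 (lie_form x)). Qed.
Lemma lieEDl x y Q : lieE (x + y) Q = lieE x Q + lieE y Q.
Proof.
elim/ext_span: Q => [|c w Q ih]; first by rewrite !lieE0 addr0.
rewrite !lieED ih [RHS]addrACA; congr (_ + _).
by rewrite !lieEW liewDl lr_anchorD scalerDl scalerDr addrACA.
Qed.
Lemma lieEZl b x Q : lieE (b *: x) Q = b *: lieE x Q + io x * ctrE b Q.
Proof.
elim/ext_span: Q => [|c w Q ih]; first by rewrite !lieE0 ctrE0 mulr0 scaler0 addr0.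
rewrite !lieED ctrED ih mulrDr scalerDr [RHS]addrACA; congr (_ + _).
rewrite !lieEW ctrEW liewZl lr_anchorZ !scalerDr !scalerA -ext_scaleAr.
by rewrite (mulrC c b) addrA.
Qed.

Fixpoint schw (w : seq g) (Q : E) : E :=
  if w is x :: u then io x * schw u Q + (-1) ^+ size u * (W u * lieE x Q) else 0.

Lemma schwDr w P Q : schw w (P + Q) = schw w P + schw w Q.
Proof.
elim: w => [|x u ih] /=; first by rewrite addr0.
by rewrite ih lieED !mulrDr addrACA.
Qed.
Lemma schwD u x y v Q : schw (u ++ (x + y) :: v) Q = schw (u ++ x :: v) Q + schw (u ++ y :: v) Q.
Proof.
elim: u => [|t u ih] /=.
  by rewrite ext_vecDE lieEDl mulrDl !mulrDr addrACA.
by rewrite ih ext_wedgeD !size_cat /= mulrDl !mulrDr addrACA.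
Qed.
Lemma schwZ u b x v Q :
  schw (u ++ (b *: x) :: v) Q = b *: schw (u ++ x :: v) Q + W (u ++ x :: v) * ctrE b Q.
Proof.
elim: u => [|t u ih] /=.
  rewrite ext_vecZE lieEZl !mulrDr -!ext_scaleAr -ext_scaleAl scalerDr addrA.
  congr (_ + _); rewrite mulrA ext_wedge_vecC ext_wedge_cons -mulrA mulrA.
  by rewrite -(mulrA ((-1) ^+ _)) signrMK.
rewrite ih ext_wedgeZ !size_cat /= mulrDr -ext_scaleAr -ext_scaleAl -ext_scaleAr.
by rewrite scalerDr ext_wedge_cons !mulrA -!addrA; congr (_ + _); rewrite addrC.
Qed.
Lemma schw_alt u x v Q : schw (u ++ x :: x :: v) Q = 0.
Proof.
elim: u => [|t u ih] /=; last by rewrite ih ext_wedge_alt mul0r !mulr0 addr0.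
rewrite mulrDr mulrA ext_vec_sqr mul0r add0r ext_signC ext_wedge_cons exprS.
by rewrite mulN1r mulNr !mulrA addrN.
Qed.

Lemma sch_form Q : ext_form (fun a w => a *: schw w Q + W w * ctrE a Q).
Proof.
split.
- by move=> a b w; rewrite scalerDl ctrEDl mulrDr addrACA.
- by move=> *; rewrite schwD ext_wedgeD scalerDr mulrDl addrACA.
- move=> a b u x v; rewrite schwZ ext_wedgeZ ctrEM scalerDr scalerA mulrDr -addrA.
  by rewrite -!ext_scaleAr -ext_scaleAl.
- by move=> *; rewrite schw_alt ext_wedge_alt mul0r scaler0 addr0.
Qed.

Definition schE (P Q : E) : E := ext_lift (fun a w => a *: schw w Q + W w * ctrE a Q) P.
Lemma schEW a w Q : schE (a *: W w) Q = a *: schw w Q + W w * ctrE a Q.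
Proof. exact: ext_lift_scale (sch_form Q). Qed.
Lemma schEDl P P' Q : schE (P + P') Q = schE P Q + schE P' Q.
Proof. exact: (ext_liftD (sch_form Q)). Qed.
Lemma schE0 Q : schE 0 Q = 0.
Proof. exact: (ext_lift0 (sch_form Q)). Qed.
Lemma schEDr P Q Q' : schE P (Q + Q') = schE P Q + schE P Q'.
Proof.
elim/ext_span: P => [|a w P ih]; first by rewrite !schE0 addr0.
rewrite !schEDl ih [RHS]addrACA; congr (_ + _).
by rewrite !schEW schwDr ctrED scalerDr mulrDr addrACA.
Qed.

Lemma ctr1 w : ctr 1 w = 0.
Proof. by elim: w => //= y v ->; rewrite lr_anchor1 scale0r mulr0 subr0 oppr0. Qed.
Lemma ctrE1 Q : ctrE 1 Q = 0.
Proof.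
by elim/ext_span: Q => [|a w Q ih]; rewrite ?ctrE0 // ctrED ih ctrEW ctr1 scaler0 addr0.
Qed.

Lemma ctr_sum a w : ctr a w =
  \sum_(i < size w) (-1) ^+ i.+1 * (D w`_i a *: W (delete_nth i w)).
Proof.
elim: w => [|y v ih] /=; first by rewrite big_ord0.
rewrite big_ord_recl /= delete_nth0 expr1 mulN1r; congr (_ + _).
rewrite ih mulr_sumr -sumrN; apply: eq_bigr => i _.
by rewrite /= /bump add1n delete_nthS ext_wedge_cons ext_signC -ext_scaleAr (exprS _ i.+1) mulN1r mulNr.
Qed.

Lemma liew_sum x w : liew x w =
  \sum_(j < size w) (-1) ^+ j * W (br x w`_j :: delete_nth j w).
Proof.
elim: w => [|y v ih] /=; first by rewrite big_ord0.
rewrite big_ord_recl /= delete_nth0 mul1r ext_wedge_cons; congr (_ + _).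
rewrite ih mulr_sumr; apply: eq_bigr => i _.
rewrite /= /bump add1n delete_nthS !ext_wedge_cons ext_signC exprS mulN1r mulNr -mulrN; congr (_ * _).
by rewrite !mulrA ext_vecC mulNr.
Qed.

Lemma schw_scalar w a : schw w (a *: (1 : E)) =
  \sum_(i < size w) (-1) ^+ (size w - i.+1) * (D w`_i a *: W (delete_nth i w)).
Proof.
elim: w => [|x u ih] /=; first by rewrite big_ord0.
rewrite big_ord_recl /= delete_nth0 subn1 /= addrC; congr (_ + _).
  rewrite -(ext_wedge_nil g) lieEW /= scaler0 addr0 ext_wedge_nil -ext_scaleAr mulr1.
  by [].
rewrite ih mulr_sumr; apply: eq_bigr => i _.
by rewrite /= /bump add1n delete_nthS subSS ext_wedge_cons ext_signC -ext_scaleAr.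
Qed.

Lemma schw_wedge xs ys : schw xs (W ys) =
  \sum_(i < size xs) \sum_(j < size ys)
     (-1) ^+ (i + j) * W (br xs`_i ys`_j :: delete_nth i xs ++ delete_nth j ys).
Proof.
elim: xs => [|x u ih] /=; first by rewrite big_ord0.
rewrite big_ord_recl /= addrC; congr (_ + _).
  rewrite -[W ys]scale1r lieEW lr_anchor1 scale0r add0r scale1r liew_sum !mulr_sumr.
  apply: eq_bigr => j _; rewrite add0n ext_signC [LHS]ext_signC; congr (_ * _).
  rewrite delete_nth0 !ext_wedge_cons (ext_wedge_cat u) !mulrA.
  by rewrite -(mulrA _ (W u)) ext_wedge_vecC !mulrA -!mulrA signrMK.
rewrite ih mulr_sumr; apply: eq_bigr => i _; rewrite mulr_sumr; apply: eq_bigr => j _.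
rewrite /= /bump add0n add1n -/(delete_nth i u).
rewrite !ext_wedge_cons ext_signC addSn exprS mulN1r mulNr -mulrN.
by congr (_ * _); rewrite !mulrA ext_vecC mulNr.
Qed.

Lemma schE_is_schouten : is_schouten schE.
Proof.
have scW (a : A) : a *: (1 : E) = a *: W [::] by rewrite ext_wedge_nil.
have schE1 w Q : schE (W w) Q = schw w Q.
  by rewrite -[W w]scale1r schEW ctrE1 mulr0 addr0 scale1r.
have sch1W a w : schE (a *: (1 : E)) (W w) = ctr a w.
  by rewrite scW schEW /= scaler0 add0r ext_wedge_nil mul1r -[W w]scale1r ctrEW scale1r.
split=> //; [exact: schEDl|exact: schEDr|..].
- by move=> a b; rewrite !scW schEW /= scaler0 add0r ctrEW /= scaler0 mulr0.
- move=> x a; rewrite -ext_wedge1 schE1 schw_scalar big_ord1 /= subnn mul1r.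
  by rewrite /delete_nth /= ext_wedge_nil.
- move=> x a; rewrite -ext_wedge1 sch1W /= mulr0 subr0 ext_wedge_nil.
  by [].
- by move=> xs a _; rewrite schE1 schw_scalar.
- by move=> a xs _; rewrite sch1W ctr_sum.
- by move=> xs ys _ _; rewrite schE1 schw_wedge.
Qed.

Lemma schouten_unique S S' : is_schouten S -> is_schouten S' -> S = S'.
Proof.
move=> h h'; apply/funext => P; apply/funext => Q.
have schouten0l T : is_schouten T -> forall q, T 0 q = 0.
  by move=> hT q; apply: (addrI (T 0 q)); rewrite -(schoutenDl hT) !addr0.
have schouten0r T : is_schouten T -> forall q, T q 0 = 0.
  by move=> hT q; apply: (addrI (T q 0)); rewrite -(schoutenDr hT) !addr0.
have abs (a : A) x w : a *: W (x :: w) = W ((a *: x) :: w).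
  by rewrite (ext_wedgeZ [::]).
elim/ext_span: P => [|a u P ihP]; first by rewrite !schouten0l.
rewrite (schoutenDl h) (schoutenDl h') ihP; congr (_ + _).
elim/ext_span: Q {ihP} => [|b v Q ihQ]; first by rewrite !schouten0r.
rewrite (schoutenDr h) (schoutenDr h') ihQ; congr (_ + _).
case: u {ihQ} => [|x u]; case: v => [|y v]; rewrite ?abs ?ext_wedge_nil.
- by rewrite (schouten_scalars h) (schouten_scalars h').
- by rewrite (schouten_scalar_wedge h) // (schouten_scalar_wedge h').
- by rewrite (schouten_wedge_scalar h) // (schouten_wedge_scalar h').
- by rewrite (schouten_wedge h) // (schouten_wedge h').
Qed.

Lemma schouten_exists : exists! S, is_schouten S.
Proof.
exists schE; split; first exact: schE_is_schouten.
by move=> S hS; apply: schouten_unique => //; exact: schE_is_schouten.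
Qed.

Definition schouten : E -> E -> E := sval (cid schouten_exists).

Lemma schoutenP : is_schouten schouten.
Proof. by have [] := svalP (cid schouten_exists). Qed.

End Schouten.

(* The sign e(s; x_1, ..., x_n) is (-1) ^+ koszul_exp d s for x_i of degree d i:
   each pair of factors exchanged in x_s(1) (x) ... (x) x_s(n) contributes the
   product of its degrees. *)
Definition koszul_exp (n : nat) (d : 'I_n -> int) (s : 'S_n) : nat :=
  \sum_(i < n) \sum_(j < n | (i < j)%N && (s j < s i)%N) (`|d (s i)| * `|d (s j)|)%N.

(* Meant for sumn ks = n; blocks of length 0 are allowed. *)
Definition Sh (n : nat) (ks : seq nat) : {set 'S_n} :=
  [set s : 'S_n | all (sorted ltn) (reshape ks [seq nat_of_ord (s i) | i : 'I_n])].

Section LieBracketsExt.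
Variables (R : realType) (A : comAlgType R) (g : lmodType A) (L : LieRinehart g).
Local Notation E := (ext g).

Definition ext_homog (d : int) (x : E) : Prop :=
  match d with Posz n => ext_power n x | Negz _ => x = 0 end.

(* All the n-ary brackets at once: the value of B on [:: x_1; ...; x_n] is the
   n-bracket {x_1, ..., x_n}_n. *)
Record is_lie_brackets (B : seq E -> E) : Prop := IsLieBrackets {
  lie_bracketsD : forall u x y v,
    B (u ++ (x + y) :: v) = B (u ++ x :: v) + B (u ++ y :: v);
  lie_brackets_nil : B [::] = 0;
  lie_brackets1 : forall x, B [:: x] = 0;
  lie_bracketsE : forall n (d : 'I_n.+2 -> int) (x : 'I_n.+2 -> E),
    (forall i, ext_homog (d i) (x i)) ->
    B [seq x i | i : 'I_n.+2] =
    \sum_(s in Sh n.+2 [:: 2; n])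
      let xs := [seq x (s i) | i : 'I_n.+2] in
      (-1) ^+ koszul_exp d s * (-1) ^+ `|d (s ord0)|%N
      * ((\prod_(y <- rev (drop 2 xs)) y) * schouten L xs`_1 xs`_0) }.

Let S := schouten L.
Definition lbH (w : seq E) : E := (\prod_(y <- rev (drop 2 w)) y) * S w`_1 w`_0.

Lemma schouten0l q : S 0 q = 0.
Proof. by apply: (addrI (S 0 q)); rewrite -(schoutenDl (schoutenP L)) !addr0. Qed.
Lemma schouten0r q : S q 0 = 0.
Proof. by apply: (addrI (S q 0)); rewrite -(schoutenDr (schoutenP L)) !addr0. Qed.

Lemma lbH_add u a b v : lbH (u ++ (a + b) :: v) = lbH (u ++ a :: v) + lbH (u ++ b :: v).
Proof.
rewrite /lbH /S; case: u => [|c [|c' u]] /=.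
- by rewrite (schoutenDr (schoutenP L)) mulrDr.
- by rewrite (schoutenDl (schoutenP L)) mulrDr.
- rewrite !drop0 !rev_cat !big_cat !rev_cons -!cats1 !big_cat !big_seq1 /=.
  by rewrite mulrDr !mulrDl.
Qed.

Lemma codom_split n (f : 'I_n -> E) (m : 'I_n) :
  [seq f i | i : 'I_n] =
  take m [seq f i | i : 'I_n] ++ f m :: drop m.+1 [seq f i | i : 'I_n].
Proof.
have sz : size [seq f i | i : 'I_n] = n by rewrite size_image card_ord.
rewrite -{1}(cat_take_drop m [seq f i | i : 'I_n]); congr (_ ++ _).
rewrite (drop_nth 0) ?sz //; congr (_ :: _).
by rewrite (nth_map m) ?size_enum_ord // nth_ord_enum.
Qed.

Lemma nth_codom n (f : 'I_n -> E) (m : 'I_n) : [seq f i | i : 'I_n]`_m = f m.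
Proof. by rewrite (nth_map m) ?size_enum_ord // nth_ord_enum. Qed.

Lemma codom_take n (f h : 'I_n -> E) (m : 'I_n) :
  (forall i, i != m -> f i = h i) ->
  take m [seq f i | i : 'I_n] = take m [seq h i | i : 'I_n] /\
  drop m.+1 [seq f i | i : 'I_n] = drop m.+1 [seq h i | i : 'I_n].
Proof.
move=> fh.
have sz (k : 'I_n -> E) : size [seq k i | i : 'I_n] = n by rewrite size_image card_ord.
have nthE i : i != m :> nat -> [seq f i | i : 'I_n]`_i = [seq h i | i : 'I_n]`_i.
  case: (ltnP i n) => [lt im|le _]; last by rewrite !nth_default ?sz.
  by rewrite -[i]/(nat_of_ord (Ordinal lt)) !nth_codom fh.
split; apply: (@eq_from_nth _ 0); rewrite ?size_take ?size_drop ?sz //.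
- rewrite ltn_ord => i im; rewrite !nth_take //.
  by apply: nthE; rewrite neq_ltn im.
- move=> i _; rewrite !nth_drop; apply: nthE.
  by rewrite neq_ltn addSn ltnS leq_addr orbT.
Qed.

Lemma lbH_fadd n (f a b : 'I_n -> E) (m : 'I_n) :
  (forall i, i != m -> f i = a i) -> (forall i, i != m -> f i = b i) ->
  f m = a m + b m ->
  lbH [seq f i | i : 'I_n] = lbH [seq a i | i : 'I_n] + lbH [seq b i | i : 'I_n].
Proof.
move=> /codom_take [ta da] /codom_take [tb db] fm.
rewrite (codom_split f m) fm lbH_add {1}ta {1}da -codom_split.
by rewrite tb db -codom_split.
Qed.

Definition lbG n (d : 'I_n.+2 -> int) (x : 'I_n.+2 -> E) : E :=
  \sum_(s in Sh n.+2 [:: 2; n])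
    (-1) ^+ koszul_exp d s * (-1) ^+ `|d (s ord0)|%N * lbH [seq x (s i) | i : 'I_n.+2].

Lemma lbG_fadd n d (f a b : 'I_n.+2 -> E) (m : 'I_n.+2) :
  (forall i, i != m -> f i = a i) -> (forall i, i != m -> f i = b i) ->
  f m = a m + b m -> lbG d f = lbG d a + lbG d b.
Proof.
move=> fa fb fm; rewrite /lbG -big_split; apply: eq_bigr => s _ /=.
rewrite -mulrDr; congr (_ * _).
have sm i : i != (s^-1)%g m -> s i != m.
  by apply: contraNneq => <-; rewrite permK.
apply: (@lbH_fadd _ _ _ _ ((s^-1)%g m)) => [i /sm /fa //|i /sm /fb //|].
by rewrite permKV.
Qed.

Lemma lbG0 n d (f : 'I_n.+2 -> E) m : f m = 0 -> lbG d f = 0.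
Proof.
move=> fm; apply: (addrI (lbG d f)); rewrite addr0.
by symmetry; apply: (@lbG_fadd _ _ _ _ _ m) => //; rewrite fm addr0.
Qed.

Definition parity_part (b : bool) : E -> E := ext_proj (fun k => odd k == b).

Lemma parity_part_homog b d x :
  ext_homog d x -> parity_part b x = if odd `|d| == b then x else 0.
Proof.
case: d => n /=; first exact: ext_proj_power.
by move=> ->; rewrite /parity_part ext_proj0 if_same.
Qed.

Definition lbF n (x : 'I_n.+2 -> E) : E :=
  \sum_(p : {ffun 'I_n.+2 -> bool})
    lbG (fun i => Posz (p i)) (fun i => parity_part (p i) (x i)).

Definition lbB (w : seq E) : E :=
  if (size w < 2)%N then 0 else lbF (fun i : 'I_(size w).-2.+2 => w`_i).

Lemma lbBE n w : size w = n.+2 -> lbB w = lbF (fun i : 'I_n.+2 => w`_i).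
Proof. by move=> sw; rewrite /lbB sw. Qed.

Lemma sign_koszul n (d d' : 'I_n -> int) (s : 'S_n) :
  (forall i, odd `|d i| = odd `|d' i|) ->
  (-1) ^+ koszul_exp d s = (-1) ^+ koszul_exp d' s :> E.
Proof.
move=> dd'; rewrite -signr_odd -[RHS]signr_odd; congr (_ ^+ nat_of_bool _).
rewrite /koszul_exp; apply: (big_ind2 (fun a b => odd a = odd b)) => //.
  by move=> a b a' b' ea eb; rewrite !oddD ea eb.
move=> i _; apply: (big_ind2 (fun a b => odd a = odd b)) => //.
  by move=> a b a' b' ea eb; rewrite !oddD ea eb.
by move=> j _; rewrite !oddM !dd'.
Qed.

Lemma lbB_is_lie_brackets : is_lie_brackets lbB.
Proof.
split=> //.
- move=> u x y v; case: (ltnP (size u + size v) 1) => [|sz].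
    case: u v => [|c u] [|c' v] //= _; rewrite /lbB /=.
    by rewrite addr0.
  have szE c : size (u ++ c :: v) = (size u + size v).-1.+2.
    by rewrite size_cat /= addnS prednK.
  rewrite !(lbBE (szE _)) /lbF -big_split; apply: eq_bigr => p _.
  have lt : (size u < (size u + size v).-1.+2)%N.
    by rewrite prednK // ltnS leq_addr.
  have nE c (i : 'I_(size u + size v).-1.+2) : i != Ordinal lt ->
      (u ++ (x + y) :: v)`_i = (u ++ c :: v)`_i.
    rewrite -val_eqE /= => ne; rewrite !nth_cat; case: ltnP => // le.
    by case E: (i - size u)%N => [|k] //=; move: ne; rewrite eqn_leq le andbT -subn_eq0 E.
  apply: (@lbG_fadd _ _ _ _ _ (Ordinal lt)).
  + by move=> i ne; rewrite (nE x).
  + by move=> i ne; rewrite (nE y).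
  + by rewrite /= !nth_cat ltnn subnn /= /parity_part ext_projD.
- move=> n d x hx; rewrite (@lbBE n); last by rewrite size_image card_ord.
  rewrite /lbF (bigD1 [ffun i => odd `|d i|]) //= [X in _ + X]big1 ?addr0.
    rewrite /lbG; apply: eq_bigr => s _.
    have -> : [seq parity_part ([ffun i0 => odd `|d i0|] (s i))
        [seq x j | j : 'I_n.+2]`_(s i) | i : 'I_n.+2] = [seq x (s i) | i : 'I_n.+2].
      apply: eq_map => i; rewrite nth_codom ffunE.
      by rewrite (parity_part_homog _ (hx _)) eqxx.
    congr (_ * _ * _).
      by apply: sign_koszul => i; rewrite ffunE /= oddb.
    by rewrite ffunE -[LHS]signr_odd /= oddb signr_odd.
  move=> p /eqP np.
  have [i pi] : exists i, p i != odd `|d i|.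
    apply: contrapT => /forallNP h; apply: np; apply/ffunP => i.
    by rewrite ffunE; apply/eqP; apply: contrapT => /negP; exact: h.
  apply: (@lbG0 _ _ _ i); rewrite nth_codom (parity_part_homog _ (hx _)).
  by rewrite eq_sym (negbTE pi).
Qed.

Lemma lie_brackets_unique B B' : is_lie_brackets B -> is_lie_brackets B' -> B = B'.
Proof.
move=> h h'; apply/funext => w.
have B0 C : is_lie_brackets C -> forall u v, C (u ++ 0 :: v) = 0.
  by move=> hC u v; apply: (addrI (C (u ++ 0 :: v))); rewrite -(lie_bracketsD hC) !addr0.
have homogE v : (forall x, x \in v -> exists d, ext_homog d x) -> B v = B' v.
  case: v => [|x [|y v]] hv.
  - by rewrite (lie_brackets_nil h) (lie_brackets_nil h').
  - by rewrite (lie_brackets1 h) (lie_brackets1 h').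
  set w' := x :: y :: v.
  have -> : w' = [seq w'`_i | i : 'I_(size v).+2].
    apply: (@eq_from_nth _ 0); rewrite ?size_image ?card_ord //= => i lti.
    by rewrite -[i in RHS]/(nat_of_ord (Ordinal lti)) nth_codom.
  have /fin_all_exists [d hd] : forall i : 'I_(size v).+2, exists d, ext_homog d w'`_i.
    by move=> i; apply: hv; apply: mem_nth.
  by rewrite (lie_bracketsE h hd) (lie_bracketsE h' hd).
suff H u : forall v, (forall x, x \in v -> exists d, ext_homog d x) ->
    B (u ++ v) = B' (u ++ v) by rewrite -(cats0 w); apply: H.
elim/last_ind: u => [|u x ih] v hv; first exact: homogE.
rewrite cat_rcons; elim/ext_span: x => [|a t x ihx]; first by rewrite !B0.
rewrite (lie_bracketsD h) (lie_bracketsD h') ihx; congr (_ + _); apply: ih => z.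
rewrite inE => /predU1P[->|]; last exact: hv.
by exists (size t)%:Z; apply: ext_powerZ; exact: ext_power_wedge.
Qed.

Lemma lie_brackets_exist : exists! B, is_lie_brackets B.
Proof.
exists lbB; split; first exact: lbB_is_lie_brackets.
by move=> B hB; apply: lie_brackets_unique => //; exact: lbB_is_lie_brackets.
Qed.

Definition lie_brackets : seq E -> E := sval (cid lie_brackets_exist).

Lemma lie_bracketsP : is_lie_brackets lie_brackets.
Proof. by have [] := svalP (cid lie_brackets_exist). Qed.

End LieBracketsExt.

Definition restrict_scalars (R : realType) (A : comAlgType R) (M : lmodType A) : Type := M.

Section RestrictScalars.
Variables (R : realType) (A : comAlgType R) (M : lmodType A).
Local Notation M_R := (restrict_scalars M).
HB.instance Definition _ := GRing.Zmodule.copy M_R M.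

Definition rs_scale (k : R) (x : M_R) : M_R := (k%:A : A) *: (x : M).

Lemma rs_scaleA a b x : rs_scale a (rs_scale b x) = rs_scale (a * b) x.
Proof. by rewrite /rs_scale scalerA -scalerAl mul1r scalerA. Qed.
Lemma rs_scale1 : left_id 1 rs_scale.
Proof. by move=> x; rewrite /rs_scale !scale1r. Qed.
Lemma rs_scaleDr : right_distributive rs_scale +%R.
Proof. by move=> k x y; rewrite /rs_scale scalerDr. Qed.
Lemma rs_scaleDl x : {morph rs_scale^~ x : a b / a + b}.
Proof. by move=> a b; rewrite /rs_scale !scalerDl. Qed.

HB.instance Definition _ := GRing.Zmodule_isLmodule.Build R M_R
  rs_scaleA rs_scale1 rs_scaleDr rs_scaleDl.
End RestrictScalars.

(* A Z-graded real vector space: the direct sum of its homogeneous components. *)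
Record gradedSpace (R : realType) := GradedSpace {
  gr_sort :> lmodType R;
  homog : int -> gr_sort -> Prop;
  homog0 : forall d, homog d 0;
  homog_linear : forall d (k : R) x y, homog d x -> homog d y -> homog d (k *: x + y);
  homog_span : forall x, exists r : seq gr_sort,
    (forall y, y \in r -> exists d, homog d y) /\ x = \sum_(y <- r) y;
  homog_indep : forall (ds : seq int) (c : int -> gr_sort), uniq ds ->
    (forall d, homog d (c d)) -> \sum_(d <- ds) c d = 0 ->
    forall d, d \in ds -> c d = 0 }.

Section LInfinity.
Variable R : realType.

(* A sequence (F_k)_{k >= 1} of k-ary maps V x ... x V -> W is encoded by one
   function on seq V, whose value at [:: x_1; ...; x_k] is F_k(x_1, ..., x_k);
   the value at [::] is irrelevant. *)
Definition multilinear (V W : lmodType R) (F : seq V -> W) : Prop :=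
  forall u v (k : R) x y,
    F (u ++ (k *: x + y) :: v) = k *: F (u ++ x :: v) + F (u ++ y :: v).

Definition graded_symmetric (V W : gradedSpace R) (F : seq V -> W) : Prop :=
  forall n (d : 'I_n -> int) (x : 'I_n -> V) (s : 'S_n), (0 < n)%N ->
    (forall i, homog (d i) (x i)) ->
    F [seq x i | i : 'I_n] = (-1) ^+ koszul_exp d s *: F [seq x (s i) | i : 'I_n].

Definition of_degree (V W : gradedSpace R) (c : int) (F : seq V -> W) : Prop :=
  forall n (d : 'I_n -> int) (x : 'I_n -> V), (0 < n)%N ->
    (forall i, homog (d i) (x i)) ->
    homog (\sum_(i < n) d i + c) (F [seq x i | i : 'I_n]).

Record Linfty_morphism (V W : gradedSpace R)
    (D : seq V -> V) (l : seq W -> W) (f : seq V -> W) : Prop := {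
  Linfty_morphism_multilinear : multilinear f;
  Linfty_morphism_symmetric : graded_symmetric f;
  Linfty_morphism_degree : of_degree 0 f;
  Linfty_morphism_eq : forall n (d : 'I_n -> int) (v : 'I_n -> V), (0 < n)%N ->
    (forall i, homog (d i) (v i)) ->
    \sum_(1 <= q < n.+1) \sum_(s in Sh n [:: q; (n - q)%N])
      (let vs := [seq v (s i) | i : 'I_n] in
       (-1) ^+ koszul_exp d s *: f (D (take q vs) :: drop q vs))
    = \sum_(1 <= p < n.+1) (p`!%:R)^-1 *:
        \sum_(k : p.-tuple 'I_n.+1 |
               all (fun j : 'I_n.+1 => (0 < j)%N) k &&
               (sumn [seq nat_of_ord j | j <- k] == n))
        \sum_(s in Sh n [seq nat_of_ord j | j <- k])
          (let vs := [seq v (s i) | i : 'I_n] in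
           (-1) ^+ koszul_exp d s *:
             l [seq f b | b <- reshape [seq nat_of_ord j | j <- k] vs]) }.

End LInfinity.

Section LieRinehartLInfinity.
Variables (R : realType) (A : comAlgType R) (g : lmodType A).

Definition assoc_graded_homog (d : int) (x : restrict_scalars (A^o * g)%type) : Prop :=
  match d with Posz 0 => x.2 = 0 | Posz 1 => x.1 = 0 | _ => x = 0 end.

Lemma assoc_graded_homog0 d : assoc_graded_homog d 0.
Proof. by case: d => [[|[|n]]|n]. Qed.

Lemma assoc_graded_homog_linear d (k : R) x y :
  assoc_graded_homog d x -> assoc_graded_homog d y -> assoc_graded_homog d (k *: x + y).
Proof.
case: d => [[|[|n]]|n] /=; case: x y => [a x] [b y] /=.
- by move=> -> ->; rewrite scaler0 addr0.
- by move=> -> ->; rewrite scaler0 addr0.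
- by move=> -> ->; rewrite scaler0 addr0.
- by move=> -> ->; rewrite scaler0 addr0.
Qed.

Lemma assoc_graded_homog_span x : exists r : seq (restrict_scalars (A^o * g)%type),
  (forall y, y \in r -> exists d, assoc_graded_homog d y) /\ x = \sum_(y <- r) y.
Proof.
case: x => a x; exists [:: (a, 0) ; (0, x)]; split=> [y|].
  by rewrite !inE => /orP[] /eqP->; [exists 0|exists 1].
by rewrite big_cons big_seq1; congr pair; rewrite /= ?addr0 ?add0r.
Qed.

Lemma assoc_graded_homog_indep (ds : seq int)
    (c : int -> restrict_scalars (A^o * g)%type) : uniq ds ->
  (forall d, assoc_graded_homog d (c d)) -> \sum_(d <- ds) c d = 0 ->
  forall d, d \in ds -> c d = 0.
Proof.
move=> uds hc s0 d dds.
have c1 e : e != 0 -> (c e).1 = 0.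
  by case: e (hc e) => [[|[|n]]|n] //= ->.
have c2 e : e != 1 -> (c e).2 = 0.
  by case: e (hc e) => [[|[|n]]|n] //= ->.
move: s0; rewrite (bigD1_seq d) //=; set T := \sum_(_ <- _ | _) _ => s0.
have T1 : d = 0 -> T.1 = 0.
  move=> d0; rewrite /T; elim/big_rec: _ => // e y; rewrite d0 => /c1 /= ce yE.
  by rewrite [LHS](_ : _ = (c e).1 + y.1) // ce yE addr0.
have T2 : d = 1 -> T.2 = 0.
  move=> d0; rewrite /T; elim/big_rec: _ => // e y; rewrite d0 => /c2 /= ce yE.
  by rewrite [LHS](_ : _ = (c e).2 + y.2) // ce yE addr0.
have s1 : (c d).1 + T.1 = 0 by rewrite -[RHS](congr1 fst s0).
have s2 : (c d).2 + T.2 = 0 by rewrite -[RHS](congr1 snd s0).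
have e1 : (c d).1 = 0.
  by have [d0|/c1 //] := eqVneq d 0; rewrite -s1 T1 ?addr0.
have e2 : (c d).2 = 0.
  by have [d1|/c2 //] := eqVneq d 1; rewrite -s2 T2 ?addr0.
by case: (c d) e1 e2 => a x /= -> ->.
Qed.

(* A (+) g, an element being a pair (a, x). *)
Definition assoc_graded : gradedSpace R :=
  GradedSpace assoc_graded_homog0 assoc_graded_homog_linear
    assoc_graded_homog_span assoc_graded_homog_indep.

Definition ext_R_homog (d : int) (x : restrict_scalars (ext g)) : Prop := ext_homog d x.

Lemma ext_R_homog0 d : ext_R_homog d 0.
Proof. by case: d => n //=; exact: ext_power0. Qed.

Lemma ext_R_homog_linear d (k : R) x y :
  ext_R_homog d x -> ext_R_homog d y -> ext_R_homog d (k *: x + y).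
Proof.
case: d => n /=; last by rewrite /ext_R_homog /= => -> ->; rewrite scaler0 addr0.
by move=> hx hy; apply: ext_powerD => //; exact: ext_powerZ.
Qed.

Lemma ext_R_homog_span x : exists r : seq (restrict_scalars (ext g)),
  (forall y, y \in r -> exists d, ext_R_homog d y) /\ x = \sum_(y <- r) y.
Proof.
elim/ext_span: x => [|a w x [r [hr ->]]].
  by exists [::]; split=> //; rewrite big_nil.
exists ((a *: ext_wedge w : ext g) :: r); split; last by rewrite big_cons.
move=> y; rewrite inE => /predU1P[->|/hr //].
by exists (size w)%:Z; apply: ext_powerZ; exact: ext_power_wedge.
Qed.

Lemma ext_R_homog_indep (ds : seq int) (c : int -> restrict_scalars (ext g)) :
  uniq ds -> (forall d, ext_R_homog d (c d)) -> \sum_(d <- ds) c d = 0 ->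
  forall d, d \in ds -> c d = 0.
Proof.
move=> uds hc s0 d dds; case: d dds (hc d) => [n|n] dds //= hn.
have := congr1 (ext_proj (fun k => k == n)) (s0 : _ = 0 :> ext g).
rewrite ext_proj0 (ext_proj_sum _ ds (c : int -> ext g)) (bigD1_seq n%:Z) //=.
rewrite (ext_proj_power _ hn) eqxx big1 ?addr0 // => e ne.
case: e ne (hc e) => m ne hm; last by rewrite [c _]hm ext_proj0.
by rewrite (ext_proj_power _ hm) -eqz_nat (negbTE ne).
Qed.

Definition ext_graded : gradedSpace R :=
  GradedSpace ext_R_homog0 ext_R_homog_linear ext_R_homog_span ext_R_homog_indep.

Variable L : LieRinehart g.

Definition assoc_graded_brackets (w : seq assoc_graded) : assoc_graded :=
  match w with
  | [:: (a, x); (b, y)] =>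
      (lr_anchor L x b + lr_anchor L y a, lr_bracket L x y)
  | _ => 0
  end.

Definition ext_graded_brackets (w : seq ext_graded) : ext_graded := lie_brackets L w.

(* An element of A (+) g as an element of the exterior algebra. *)
Definition assoc_graded_ext (z : assoc_graded) : ext g :=
  (z.1 : A) *: (1 : ext g) + ext_vec z.2.

Definition i_infty (w : seq assoc_graded) : ext_graded :=
  ((-1) ^+ (size w - 1) * ((size w - 1)`!)%:R : R) *:
    (\prod_(z <- rev w) assoc_graded_ext z : ext_graded).

End LieRinehartLInfinity.

(* Main.v *)
Require Import Defs.
From mathcomp Require Import all_boot all_order all_fingroup all_algebra.
From mathcomp Require Import reals.
From mathcomp Require Import zify ring.

Set Implicit Arguments.
Unset Strict Implicit.
Unset Printing Implicit Defensive.

Import Order.TTheory GRing.Theory Num.Theory.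

(** Multilinearity, graded symmetry and degree 0 of i_infty are immediate, since
i_n is a real multiple of a product in the graded commutative exterior algebra.
The content is the morphism equation.  For n = 1 both sides
vanish.  For n >= 2 both sides turn out to be the same multiple of one element
of the exterior algebra,

  T0 = sum over all s in S_n of
       e(s) e(x_s(1)) x_s(n) /\ ... /\ x_s(3) /\ [x_s(2), x_s(1)],

where [ , ] is the Schouten-Nijenhuis bracket.

On the left only the binary bracket of A (+) g contributes, and up to the sign
e(x_1) that bracket is the Schouten-Nijenhuis bracket of x_2 and x_1.  A sum
over Sh(2, n-2) of a function symmetric inside the two blocks is a sum over
S_n divided by 2! (n-2)!, so with the coefficient (-1)^(n-2) (n-2)! of i_(n-1)
the left side is (-1)^n / 2 times T0 (morphism_lhs).

On the right the sum over Sh(k_1, ..., k_p) becomes likewise a sum over S_n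
(sum_perms_shuffle), which divides the coefficient (-1)^(k-1) (k-1)! of i_k
by k! and leaves (-1)^(k-1) / k for each block.  The p-bracket of the wedges
X_1, ..., X_p of the blocks is a sum over pairs of blocks of terms
X /\ [X_b, X_a] with X a wedge of the other blocks.  Inside a Koszul-signed
sum over S_n the blocks may be moved freely (koszul_sum_perm), and then the
graded Leibniz rule shows that each of the k_a k_b ways to pick one letter
from X_a and one from X_b contributes one copy of T0
(koszul_sum_bracket_term).

It remains to add up numbers: the right side is T0 / 2 times the sum over p of
1 / (p-2)! times the coefficient of X^n in Q^2 L^(p-2), where
L = X - X^2/2 + X^3/3 - ... = log (1 + X) carries the weights (-1)^(k-1) / k
and Q = X - X^2 + X^3 - ... = X / (1 + X) those of the two distinguished
blocks.  As Q^2 exp L = X^2 / (1 + X), whose coefficient of X^n is (-1)^n, the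
two sides agree (sum_compositions_alternating, morphism_rhs).

Permutations s are handled as words s(0) ... s(n-1) over the natural numbers,
so that blocks of a shuffle are factors of a word and moving blocks is an
operation on lists. *)

(** * Koszul signs of words *)

Section KoszulWords.
Local Open Scope nat_scope.
Variable d : nat -> nat.

Definition word_degree (w : seq nat) := \sum_(x <- w) d x.

(** The inversions between a letter of u and a letter of v in the word u ++ v,
each weighted by the product of the two degrees. *)
Definition crossing (u v : seq nat) :=
  \sum_(x <- u) \sum_(y <- v | y < x) d x * d y.

(** The exponent of the Koszul sign of a word, organised by first letter so that
it splits along concatenations (koszul_word_cat). *)
Fixpoint koszul_word (w : seq nat) :=
  if w is x :: v then crossing [:: x] v + koszul_word v else 0.

Lemma word_degree_cat u v : word_degree (u ++ v) = word_degree u + word_degree v.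
Proof. exact: big_cat. Qed.

Lemma crossing_catl u v w : crossing (u ++ v) w = crossing u w + crossing v w.
Proof. exact: big_cat. Qed.

Lemma crossing_catr u v w : crossing u (v ++ w) = crossing u v + crossing u w.
Proof. by rewrite -big_split; apply: eq_bigr => x _; rewrite big_cat. Qed.

Lemma koszul_word_cat u v :
  koszul_word (u ++ v) = koszul_word u + koszul_word v + crossing u v.
Proof.
elim: u => [|x u ih] /=; first by rewrite /crossing big_nil addn0.
rewrite ih crossing_catr -[x :: u]cat1s crossing_catl; lia.
Qed.

(** Two distinct letters are inverted in exactly one of the two orders. *)
Lemma crossing_sym u v : uniq (u ++ v) ->
  crossing u v + crossing v u = word_degree u * word_degree v.
Proof.
rewrite cat_uniq => /and3P[_ /hasPn uv _].
rewrite /crossing [X in _ + X](exchange_big_dep xpredT) //= -big_split /=.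
rewrite /word_degree big_distrl /= big_seq [RHS]big_seq; apply: eq_bigr => x xu.
rewrite big_distrr /= [RHS](bigID (fun y => y < x)) /=; congr (_ + _).
rewrite big_seq_cond [RHS]big_seq_cond; apply: congr_big => //= [y|y _]; last exact: mulnC.
case yv : (y \in v) => //=; rewrite -leqNgt [in RHS]leq_eqVlt; case: eqP => //= xy.
by have := uv y yv; rewrite -xy /= xu.
Qed.

(** Exchanging two adjacent blocks of a word multiplies its Koszul sign by
(-1)^(|a| |b|): only the inversions between the two blocks change.  The other
sign rules for words come from this one. *)
Lemma koszul_word_swap u a b v : uniq (u ++ a ++ b ++ v) ->
  odd (koszul_word (u ++ b ++ a ++ v)) =
  odd (koszul_word (u ++ a ++ b ++ v)) (+) odd (word_degree a * word_degree b).
Proof.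
move=> un; rewrite -crossing_sym; last first.
  by move: un; rewrite cat_uniq catA cat_uniq => /and3P[_ _ /andP[]].
rewrite -oddD !koszul_word_cat !crossing_catr.
set x := crossing a b; set y := crossing b a.
lia.
Qed.

Lemma koszul_word_sorted w : sorted ltn w -> koszul_word w = 0.
Proof.
elim: w => //= x w ih pxw; rewrite ih ?(path_sorted pxw) // addn0 /crossing big_seq1.
rewrite big_seq_cond big1 // => y /andP[yw yx].
move: (order_path_min ltn_trans pxw) => /allP/(_ _ yw) xy.
by rewrite ltnNge ltnW in yx.
Qed.

End KoszulWords.

(** Adjacent transpositions generate the symmetric group.  The hypothesis is
only asked for rearrangements of w, so that the exchange rule may rely
on the letters being distinct. *)
Lemma perm_swap_invariant (T : eqType) (M : Type) (F : seq T -> M) (w w' : seq T) :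
  (forall u x y v, perm_eq (u ++ x :: y :: v) w ->
     F (u ++ x :: y :: v) = F (u ++ y :: x :: v)) ->
  perm_eq w w' -> F w = F w'.
Proof.
move=> swapF.
have front u x v t : perm_eq (t ++ u ++ x :: v) w -> F (t ++ u ++ x :: v) = F (t ++ x :: u ++ v).
  elim/last_ind: u v => [|u y ih] v //= pw; rewrite !cat_rcons catA in pw *.
  rewrite swapF // -catA ih // catA; apply: perm_trans pw.
  by rewrite perm_cat2l -(cat1s x (y :: v)) -(cat1s y (x :: v)) -(cat1s x v) -(cat1s y v) perm_catCA.
suff H t v v' : perm_eq v v' -> perm_eq (t ++ v) w -> F (t ++ v) = F (t ++ v').
  by move=> ww; apply: (H [::]).
elim: v' v t => [|x v' ih] v t; first by move=> /perm_nilP ->.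
move=> vv; have xv : x \in v by rewrite (perm_mem vv) mem_head.
case/splitPr: xv vv => u s; rewrite -[x :: s]cat1s perm_catCA /= perm_cons => us tw.
rewrite front // -!cat_rcons; apply: ih => //; rewrite cat_rcons.
by rewrite -(permPr tw) perm_cat2l -(cat1s x s) perm_sym perm_catCA.
Qed.

(** The Koszul sign is a cocycle for permutations of blocks: a rearrangement t of
blocks changes the sign of the concatenation by the Koszul sign of t itself,
where a block has the sum of the degrees of its letters. *)
Lemma koszul_word_blocks d (bs : seq (seq nat)) (t : seq nat) :
  uniq (flatten bs) -> perm_eq t (iota 0 (size bs)) ->
  odd (koszul_word d (flatten [seq nth [::] bs j | j <- t])) =
  odd (koszul_word d (flatten bs)) (+)
  odd (koszul_word (fun j => word_degree d (nth [::] bs j)) t).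
Proof.
set B := nth [::] bs; set D := (fun j => word_degree d _) => ubs pt.
pose F (t : seq nat) := odd (koszul_word d (flatten (map B t))) (+) odd (koszul_word D t).
have mapB : map B (iota 0 (size bs)) = bs by rewrite map_nth_iota0 ?take_size.
(* The product of the two signs does not change when two blocks are exchanged. *)
have FE : F t = F (iota 0 (size bs)).
  apply: (perm_swap_invariant _ pt) => u x y v put.
  have pb : perm_eq (u ++ x :: y :: v) (iota 0 (size bs)) by rewrite (perm_trans put).
  have := perm_flatten (perm_map B pb).
  rewrite mapB map_cat /= flatten_cat /= => /perm_uniq; rewrite ubs => un.
  have uxy : uniq (u ++ [:: x] ++ [:: y] ++ v) by rewrite (perm_uniq pb) iota_uniq.
  rewrite /F !map_cat /= !flatten_cat /= (koszul_word_swap d un).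
  rewrite (koszul_word_swap D uxy) /word_degree !big_seq1 /=.
  by rewrite addbACA addbb addbF.
rewrite /F mapB (@koszul_word_sorted _ (iota _ _)) ?iota_ltn_sorted // addbF in FE.
by rewrite -FE addbK.
Qed.

(** * Permutations as words *)

Definition perm_word n (s : 'S_n) : seq nat := [seq nat_of_ord (s i) | i : 'I_n].

Lemma koszul_exp_word n (dn : 'I_n -> int) (d : nat -> nat) (s : 'S_n) :
  (forall i : 'I_n, d i = `|dn i|%N) -> koszul_exp dn s = koszul_word d (perm_word s).
Proof.
move=> dE; rewrite /koszul_exp /perm_word /=.
under eq_bigr do under eq_bigr do rewrite -!dE.
suff H m (f : 'I_m -> nat) : (\sum_(i < m) \sum_(j < m | (i < j) && (f j < f i)) d (f i) * d (f j) =
    koszul_word d [seq f i | i : 'I_m])%N by rewrite H.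
elim: m f => [|m ih] f; first by rewrite big_ord0 /image_mem enum_ord0.
rewrite /image_mem enum_ordSl /= -map_comp big_ord_recl; congr (_ + _)%N; last first.
  rewrite -[X in koszul_word d X]/([seq f (lift ord0 i) | i : 'I_m]) -ih.
  apply: eq_bigr => i _; rewrite big_mkcond big_ord_recl /= add0n [RHS]big_mkcond /=.
  by apply: eq_bigr => j _; rewrite /bump !add1n ltnS.
rewrite /crossing big_seq1 big_map big_mkcond big_ord_recl ltnn /= add0n -big_mkcond /=.
by rewrite big_enum_cond.
Qed.

Lemma perm_wordP n (w : seq nat) :
  reflect (exists s : 'S_n, w = perm_word s) (perm_eq w (iota 0 n)).
Proof.
have iE : iota 0 n = [seq val i | i <- enum 'I_n] by rewrite val_enum_ord.
apply: (iffP idP) => [|[s ->]].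
  move=> pw; have sw : size w == n by rewrite (perm_size pw) size_iota.
  have /tuple_permP[s wE] : perm_eq w (map_tuple val (ord_tuple n)).
    by rewrite (perm_trans pw) // iE.
  exists s; rewrite wE /perm_word; apply: eq_map => i.
  by rewrite tnth_map tnth_ord_tuple.
have -> : perm_word s = map val (map s (enum 'I_n)) by rewrite -map_comp.
rewrite iE; apply/perm_map/uniq_perm.
- by rewrite map_inj_uniq ?enum_uniq //; exact: perm_inj.
- exact: enum_uniq.
- move=> i; rewrite mem_enum inE; apply/mapP; exists (s^-1%g i); first by rewrite mem_enum.
  by rewrite permKV.
Qed.

Lemma perm_word_inj n : injective (@perm_word n).
Proof.
move=> s t /eq_in_map st; apply/permP => i; apply/val_inj/st.
by rewrite mem_enum.
Qed.

Lemma nth_image_ord (T : Type) (x0 : T) n (f : 'I_n -> T) (i : 'I_n) :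
  nth x0 [seq f i | i : 'I_n] i = f i.
Proof. by rewrite (nth_map i) ?size_enum_ord // nth_ord_enum. Qed.

Lemma size_perm_word n (s : 'S_n) : size (perm_word s) = n.
Proof. by rewrite size_image card_ord. Qed.

Lemma nth_perm_word n (s : 'S_n) (i : 'I_n) : nth 0%N (perm_word s) i = s i.
Proof. by rewrite (nth_map i) ?size_enum_ord // nth_ord_enum. Qed.

Lemma perm_word_perm n (s : 'S_n) : perm_eq (perm_word s) (iota 0 n).
Proof. by apply/perm_wordP; exists s. Qed.

Lemma perm_word1 n : perm_word (1%g : 'S_n) = iota 0 n.
Proof. by rewrite -val_enum_ord; apply: eq_map => i; rewrite perm1. Qed.

Lemma map_perm_word (T : Type) (x0 : T) n (x : 'I_n -> T) (s : 'S_n) :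
  [seq x (s i) | i : 'I_n] = [seq nth x0 [seq x i | i : 'I_n] j | j <- perm_word s].
Proof.
rewrite /perm_word -map_comp; apply: eq_map => i /=.
by rewrite (nth_map (s i)) ?size_enum_ord // nth_ord_enum.
Qed.

Definition shuffle (ks : seq nat) (w : seq nat) := all (sorted ltn) (reshape ks w).

Lemma sum_perm_word (M : nmodType) n (P : pred (seq nat)) (F : seq nat -> M) :
  (\sum_(s : 'S_n | P (perm_word s)) F (perm_word s) =
   \sum_(w <- permutations (iota 0 n) | P w) F w)%R.
Proof.
have pE : perm_eq [seq perm_word s | s : 'S_n] (permutations (iota 0 n)).
  apply: uniq_perm; rewrite ?permutations_uniq //.
    by rewrite map_inj_uniq ?enum_uniq //; exact: perm_word_inj.
  move=> w; rewrite mem_permutations; apply/mapP/perm_wordP => [[s _ ->]|[s ->]].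
    by exists s.
  by exists s; rewrite ?mem_enum.
by rewrite -(perm_big _ pE) /= big_map big_enum_cond; apply: eq_bigl.
Qed.

Lemma sum_Sh_word (M : nmodType) n ks (F : seq nat -> M) :
  (\sum_(s in Sh n ks) F (perm_word s) =
   \sum_(w <- permutations (iota 0 n) | shuffle ks w) F w)%R.
Proof. by rewrite -sum_perm_word; apply: eq_bigl => s; rewrite inE. Qed.

(** * Sums over shuffles *)

Fixpoint block_perms (bs : seq (seq nat)) : seq (seq (seq nat)) :=
  if bs is b :: bs' then [seq x :: y | x <- permutations b, y <- block_perms bs']
  else [:: [::]].

Lemma mem_block_perms bs xs : (xs \in block_perms bs) = all2 (fun x b => perm_eq x b) xs bs.
Proof.
elim: bs xs => [|b bs ih] [|x xs] //=.
  by apply/negbTE/negP => /allpairsP[[y ys] /= []].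
rewrite -ih -mem_permutations; apply/allpairsP/andP => [[[y ys] /= [hy hys [-> ->]]]|[]] //.
by exists (x, xs).
Qed.

Lemma block_perms_uniq bs : uniq (block_perms bs).
Proof.
elim: bs => //= b bs ih; apply: allpairs_uniq => //; first exact: permutations_uniq.
by move=> [x y] [x' y'] _ _ /= [-> ->].
Qed.

Lemma size_block_perms bs : all uniq bs ->
  size (block_perms bs) = \prod_(k <- shape bs) k`!.
Proof.
elim: bs => [|b bs ih] /=; first by rewrite big_nil.
by case/andP=> ub ubs; rewrite size_allpairs ih // size_permutations // big_cons.
Qed.

Lemma all2_perm_shape (xs bs : seq (seq nat)) :
  all2 (fun x b => perm_eq x b) xs bs -> shape xs = shape bs.
Proof. by elim: xs bs => [|x xs ih] [|b bs] //= /andP[/perm_size -> /ih ->]. Qed.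

Lemma all2_perm_flatten (xs bs : seq (seq nat)) :
  all2 (fun x b => perm_eq x b) xs bs -> perm_eq (flatten xs) (flatten bs).
Proof.
by elim: xs bs => [|x xs ih] [|b bs] //= /andP[xb /ih]; exact: perm_cat.
Qed.

(** Symmetry inside each block is stated through adjacent letters, the form in
which it can be checked for functions involving a sign; only the block lists
of shape ks cut from a permutation word are concerned. *)
Definition block_symmetric (M : Type) (ks : seq nat) (F : seq (seq nat) -> M) :=
  forall pre u x y v post,
    shape (pre ++ (u ++ x :: y :: v) :: post) = ks ->
    perm_eq (flatten (pre ++ (u ++ x :: y :: v) :: post)) (iota 0 (sumn ks)) ->
    F (pre ++ (u ++ x :: y :: v) :: post) = F (pre ++ (u ++ y :: x :: v) :: post).

Lemma block_symmetric_perm (M : Type) ks (F : seq (seq nat) -> M) xs bs :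
  block_symmetric ks F -> shape xs = ks ->
  perm_eq (flatten xs) (iota 0 (sumn ks)) ->
  all2 (fun x b => perm_eq x b) xs bs -> F xs = F bs.
Proof.
move=> FS; suff H pre : shape (pre ++ xs) = ks ->
    perm_eq (flatten (pre ++ xs)) (iota 0 (sumn ks)) ->
    all2 (fun x b => perm_eq x b) xs bs -> F (pre ++ xs) = F (pre ++ bs) by exact: (H [::]).
elim: xs bs pre => [|x xs ih] [|b bs] pre //= sxs pxs /andP[xb xbs].
rewrite -[pre ++ b :: bs]cat_rcons -ih //; last 2 first.
- by rewrite cat_rcons -sxs /shape !map_cat /= (perm_size xb).
- rewrite cat_rcons -(permPr pxs) !flatten_cat /= perm_cat2l perm_cat2r.
  by rewrite perm_sym.
rewrite cat_rcons; apply: (@perm_swap_invariant _ _ (fun z => F (pre ++ z :: xs))) xb.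
move=> u y z v pu; apply: FS; last first.
  by rewrite -(permPr pxs) !flatten_cat /= perm_cat2l perm_cat2r.
by rewrite -sxs /shape !map_cat /= (perm_size pu).
Qed.

Lemma perm_sort_leq (u v : seq nat) : perm_eq u v -> sort leq u = sort leq v.
Proof. by move=> uv; apply/(perm_sortP leq_total leq_trans anti_leq). Qed.

(** Sorting every block maps the words onto the shuffles, and the fibre over a
shuffle consists of the words obtained by permuting the letters inside each
block, of which there are prod k!. *)
Lemma sum_perms_shuffle (M : nmodType) n ks (F : seq (seq nat) -> M) :
  sumn ks = n -> block_symmetric ks F ->
  (\sum_(w <- permutations (iota 0 n)) F (reshape ks w) =
   (\sum_(w <- permutations (iota 0 n) | shuffle ks w) F (reshape ks w))
     *+ \prod_(k <- ks) k`!)%R.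
Proof.
move=> sks FS; set P := permutations _.
have szP w : w \in P -> size w = n.
  by rewrite mem_permutations => /perm_size ->; rewrite size_iota.
have shP w : w \in P -> shape (reshape ks w) = ks.
  by move=> /szP sw; rewrite reshapeKl // sw sks.
have flP w : w \in P -> flatten (reshape ks w) = w.
  by move=> /szP sw; rewrite reshapeKr // sw sks.
(* st sorts each block, and so lands in the shuffles. *)
pose st w := flatten (map (sort leq) (reshape ks w)).
have shs xs : shape (map (sort leq) xs) = shape xs.
  by rewrite /shape -map_comp; apply: eq_map => x /=; rewrite size_sort.
have rst w : w \in P -> reshape ks (st w) = map (sort leq) (reshape ks w).
  by move=> wP; rewrite /st -{1}(shP w wP) -shs flattenK.
have psort xs : all2 (fun x b => perm_eq x b) xs (map (sort leq) xs).
  by elim: xs => //= x xs ->; rewrite andbT perm_sym perm_sort.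
have pst w : w \in P -> perm_eq w (st w).
  move=> wP; rewrite -{1}(flP w wP); exact: all2_perm_flatten (psort _).
have stP w : w \in P -> st w \in P.
  by move=> wP; move: (wP); rewrite !mem_permutations; apply: perm_trans; rewrite perm_sym; exact: pst.
have uP w : w \in P -> uniq w.
  by rewrite mem_permutations => /perm_uniq ->; exact: iota_uniq.
have ubl w : w \in P -> all uniq (reshape ks w).
  move=> wP; have := uP w wP; rewrite -{1}(flP w wP).
  elim: (reshape ks w) => //= b bs ih; rewrite cat_uniq => /and3P[-> _ ?] /=.
  exact: ih.
have stS w : w \in P -> shuffle ks (st w).
  move=> wP; rewrite /shuffle rst // all_map; apply/allP => b bw /=.
  rewrite ltn_sorted_uniq_leq sort_uniq sort_sorted ?andbT; last exact: leq_total.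
  exact: (allP (ubl w wP)).
(* Group the words by their image under st. *)
transitivity (\sum_(w <- P) \sum_(u <- P | shuffle ks u && (u == st w)) F (reshape ks u))%R.
  rewrite [LHS]big_seq [RHS]big_seq; apply: eq_bigr => w wP.
  rewrite big_mkcond (bigD1_seq (st w)) ?stP ?permutations_uniq //= stS // eqxx /=.
  rewrite big1 => [|u /negbTE ->]; last by rewrite andbF.
  rewrite addr0 rst //; apply: (block_symmetric_perm FS) (psort _); first by rewrite shP.
  by rewrite flP // sks -mem_permutations.
rewrite (exchange_big_dep (shuffle ks)) /=; last by move=> w u _ /andP[].
rewrite [RHS](big_morph (fun x => x *+ _)%R (fun x y => mulrnDl _ x y) (mul0rn _ _)).
rewrite big_seq_cond [RHS]big_seq_cond; apply: eq_bigr => u /andP[uP' uS].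
rewrite big_const_seq iter_addr_0 uS /=; congr (_ *+ _)%R.
(* The fibre of st over u is enumerated by the blockwise permutations of u. *)
rewrite -{1}(shP u uP') -size_block_perms ?ubl // -size_filter -(size_map flatten).
have shB xs : xs \in block_perms (reshape ks u) -> shape xs = ks.
  by rewrite mem_block_perms => /all2_perm_shape ->; rewrite shP.
apply: perm_size; apply: uniq_perm.
- by rewrite filter_uniq // permutations_uniq.
- rewrite map_inj_in_uniq ?block_perms_uniq // => xs ys /shB sx /shB sy xy.
  by apply: eq_from_flatten_shape; rewrite // sx sy.
move=> w; rewrite mem_filter; apply/andP/mapP => [[/eqP uw wP]|[xs xsB ->]].
  exists (reshape ks w); last by rewrite flP.
  by rewrite mem_block_perms uw rst //; exact: psort.
have xsu := xsB; rewrite mem_block_perms in xsu.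
have fxs : flatten xs \in P.
  have := all2_perm_flatten xsu; rewrite flP // mem_permutations => /perm_trans.
  by apply; rewrite -mem_permutations.
split=> //; rewrite /st -{1}(shB xs xsB) flattenK -{1}(flP u uP'); apply/eqP; congr flatten.
move: (reshape ks u) xsu (uS : all _ _) => bs xsu.
elim: {xsB fxs} xs bs xsu => [|x xs ih] [|b bs] //= /andP[xb xbs] /andP[sb sbs].
rewrite (perm_sort_leq xb) -(ih bs) // sorted_sort //; first exact: leq_trans.
by move: sb; rewrite ltn_sorted_uniq_leq => /andP[].
Qed.

Local Open Scope ring_scope.

(** This is the count of shuffles obtained from a constant function. *)
Lemma card_Sh_2 (F : numFieldType) p : #|Sh p.+2 [:: 2; p]%N|%:R = p.+2`!%:R / (2 * p`!)%:R :> F.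
Proof.
have sp : sumn [:: 2; p]%N = p.+2 by rewrite /= addn0.
have := @sum_perms_shuffle F p.+2 _ (fun=> 1) sp (fun _ _ _ _ _ _ _ _ => erefl).
rewrite -(sum_Sh_word _ _ (fun=> 1)) !big_cons big_nil muln1 => E.
have nz : (2 * p`!)%:R != 0 :> F by rewrite pnatr_eq0 muln_eq0 /= -lt0n fact_gt0.
apply: (mulIf nz); rewrite mulfVK // mulr_natr -sumr_const -E.
by rewrite big_const_seq iter_addr_0 count_predT size_permutations ?iota_uniq ?size_iota.
Qed.

(** * A sum over compositions *)

Section Compositions.
Variable F : numFieldType.

(** The parts are drawn from a bounded finite type so that compositions of n can
index a finite sum; the bound n is harmless since no part exceeds the sum. *)
Definition is_composition n p (k : p.-tuple 'I_n.+1) :=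
  all (fun j : 'I_n.+1 => (0 < j)%N) k && (sumn [seq nat_of_ord j | j <- k] == n).

(** Power series without constant term, cut off after degree n: enough to read
off coefficients up to degree n. *)
Definition truncated_series (c : nat -> F) n : {poly F} :=
  \sum_(i < n.+1 | (0 < i)%N) c i *: 'X^i.

Lemma coef_truncated_series c n i :
  (truncated_series c n)`_i = if (0 < i <= n)%N then c i else 0.
Proof.
rewrite coef_sum; under eq_bigr do rewrite coefZ coefXn.
case: ifP => [/andP[i0 lin]|li].
  have lt : (i < n.+1)%N by [].
  rewrite (bigD1 (Ordinal lt)) //= eqxx mulr1 big1 ?addr0 // => j /andP[_ nj].
  by rewrite (_ : _ == _ = false) ?mulr0 //; apply/eqP => ij; case/eqP: nj; apply/val_inj.
rewrite big1 // => j j0; case: eqP => [ij|]; rewrite ?mulr0 //.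
by move: li; rewrite ij j0 -ltnS ltn_ord.
Qed.

Lemma sum_compositions p n (c : nat -> nat -> F) :
  \sum_(k : p.-tuple 'I_n.+1 | is_composition k) \prod_(j < p) c j (tnth k j)
  = (\prod_(j < p) truncated_series (c j) n)`_n.
Proof.
rewrite bigA_distr_big /= coef_sum.
rewrite (reindex (fun h : {ffun 'I_p -> 'I_n.+1} => [tuple h i | i < p])) /=; last first.
  exists (fun t : p.-tuple 'I_n.+1 => [ffun i => tnth t i]) => [h _|t _].
    by apply/ffunP => i; rewrite ffunE tnth_mktuple.
  by apply/eq_from_tnth => i; rewrite tnth_mktuple ffunE.
rewrite big_mkcondr [LHS]big_mkcond [RHS]big_mkcond; apply: eq_bigr => h _ /=.
have -> : all (fun j : 'I_n.+1 => (0 < j)%N) [seq h i | i : 'I_p] =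
          (h \in ffun_on (fun i : 'I_n.+1 => (0 < i)%N)).
  apply/allP/ffun_onP => [hp i|hp j /mapP[i _ ->]]; last exact: hp.
  by apply: hp; apply: map_f; rewrite mem_enum.
case: ifP => // _; rewrite scaler_prod prodrXr coefZ coefXn.
rewrite -map_comp sumnE big_map big_enum /= eq_sym.
have -> : \prod_(i < p) c i (tnth [tuple h i | i < p] i) = \prod_(i < p) c i (h i).
  by apply: eq_bigr => i _; rewrite tnth_mktuple.
by case: eqP => _; rewrite ?mulr1 ?mulr0.
Qed.

(** log (1 + X), truncated. *)
Definition log_poly n := truncated_series (fun i => (-1) ^+ i.-1 / i%:R) n.
(** X / (1 + X), truncated. *)
Definition ratio_poly n := truncated_series (fun i => (-1) ^+ i.-1) n.
(** The first M + 1 terms of the exponential series evaluated at log_poly n. *)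
Definition exp_log_poly n M : {poly F} := \sum_(i < M.+1) i`!%:R^-1 *: log_poly n ^+ i.

Lemma coef_exp_small (P : {poly F}) m i : P`_0 = 0 -> (i < m)%N -> (P ^+ m)`_i = 0.
Proof.
move=> P0; elim: m i => // m ih i lim; rewrite exprS coefM big1 // => j _.
case: (ltnP (i - j)%N m) => [/ih ->|le]; first by rewrite mulr0.
have -> : j = 0%N :> nat by have := ltn_ord j; lia.
by rewrite P0 mul0r.
Qed.

Lemma deriv_exp_log n M :
  (exp_log_poly n M.+1)^`() = (log_poly n)^`() * exp_log_poly n M.
Proof.
rewrite /exp_log_poly big_ord_recl /= expr0 derivD derivZ -polyC1 derivC scaler0 add0r.
rewrite raddf_sum mulr_sumr; apply: eq_bigr => i _.
rewrite /= derivZ /bump add1n deriv_exp /= -scaler_nat scalerA factS natrM invfM mulrAC.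
rewrite mulVf ?pnatr_eq0 // mul1r.
by rewrite scalerAr.
Qed.

(** Truncated form of (1 + X) (log (1 + X))' = 1. *)
Lemma coef_deriv_log n i : (i < n)%N -> ((1 + 'X) * (log_poly n)^`())`_i = (i == 0%N)%:R.
Proof.
have dL j : (j < n)%N -> (log_poly n)^`()`_j = (-1) ^+ j.
  move=> jn; rewrite coef_deriv coef_truncated_series /= jn -[_ *+ _]mulr_natr.
  by rewrite mulfVK ?pnatr_eq0.
move=> lin; rewrite mulrDl mul1r coefD coefXM dL //.
case: i lin => [|i] lin; rewrite ?addr0 //=.
by rewrite dL ?(ltnW lin) // exprS mulN1r addNr.
Qed.

Lemma exp_log_stable n M m : (m < M)%N ->
  (exp_log_poly n M)`_m = (exp_log_poly n M.-1)`_m.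
Proof.
case: M => // M lmM; rewrite /exp_log_poly big_ord_recr /= coefD coefZ coef_exp_small ?mulr0 ?addr0 //.
by rewrite coef_truncated_series.
Qed.

(** Coefficientwise form of the differential equation (1 + X) E' = E satisfied by
E = exp (log (1 + X)). *)
Lemma exp_log_recur n M m : (m < M)%N -> (M <= n)%N ->
  (exp_log_poly n M)`_m.+1 *+ m.+1 + (exp_log_poly n M)`_m *+ m = (exp_log_poly n M)`_m.
Proof.
case: M => // M lmM lMn; rewrite [RHS]exp_log_stable //=.
have := congr1 (fun P : {poly F} => ((1 + 'X) * P)`_m) (deriv_exp_log n M).
rewrite mulrA [X in _ = X -> _]coefM big_ord_recl /= coef_deriv_log ?(leq_trans _ lMn) //.
rewrite subn0 mul1r big1 ?addr0 => [<-|i _].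
  rewrite mulrDl mul1r coefD coefXM !coef_deriv; congr (_ + _).
  by case: (m) => [|k] /=; rewrite ?mulr0n ?coef_deriv.
rewrite coef_deriv_log ?mul0r //= /bump add1n.
by have := ltn_ord i; lia.
Qed.

(** exp (log (1 + X)) = 1 + X: the recursion forces the coefficients 1, 1, 0, 0, ... *)
Lemma coef_exp_log n M m : (m <= M)%N -> (M <= n)%N ->
  (exp_log_poly n M)`_m = (m <= 1)%:R.
Proof.
move=> lmM lMn; elim: m lmM => [_|m ih lmM].
  rewrite /exp_log_poly coef_sum big_ord_recl /= expr0 coefZ coef1 mulr1 invr1.
  by rewrite big1 ?addr0 // => i _; rewrite coefZ coef_exp_small ?mulr0 ?coef_truncated_series.
have := exp_log_recur lmM lMn; rewrite ih ?(ltnW lmM) //.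
have e0 (x : F) k : x *+ k.+1 = 0 -> x = 0.
  by move=> /eqP; rewrite mulrn_eq0 /= => /eqP.
case: (m) => [|[|k]] /=; first by rewrite mulr1n mulr0n addr0.
  by rewrite mulr1n => h; apply: (e0 _ 1%N); apply: (addIr 1); rewrite h add0r.
by rewrite mul0rn addr0; exact: e0.
Qed.

(** Truncated form of (X / (1 + X))^2 (1 + X) = X^2 / (1 + X). *)
Lemma coef_ratio_exp_log n : (2 <= n)%N ->
  (ratio_poly n ^+ 2 * exp_log_poly n n.-2)`_n = (-1) ^+ n.
Proof.
move=> n2; have -> : (ratio_poly n ^+ 2 * exp_log_poly n n.-2)`_n =
    (ratio_poly n * (ratio_poly n * (1 + 'X)))`_n.
  (* ratio_poly n ^+ 2 is divisible by X^2, so only the coefficients of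
     exp_log_poly of degree at most n - 2 matter; those are the ones of 1 + X. *)
  rewrite mulrA -expr2 !coefMr; apply: eq_bigr => i _.
  case: (leqP i n.-2) => lin.
    rewrite coef_exp_log //; last lia.
    by rewrite coefD coef1 coefX; case: (nat_of_ord i) => [|[|k]]; rewrite ?addr0 ?add0r.
  rewrite coef_exp_small ?mul0r ?coef_truncated_series //.
  by have := ltn_ord i; lia.
have -> : ratio_poly n * (1 + 'X) = 'X - (-1) ^+ n *: 'X^(n.+1).
  case: n n2 => [|[|n]] // _; apply/polyP => i.
  rewrite mulrDr mulr1 !coefD coefMX coefN coefZ coefX coefXn !coef_truncated_series.
  case: i => [|[|i]] /=; rewrite ?eqSS ?addr0 ?mulr0 ?subr0 //.
  rewrite sub0r; case: (ltngtP i n.+1) => [lt|gt|->].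
  - by rewrite ltnS lt ltnS (ltnW lt) mulr0 oppr0 exprS mulN1r addNr.
  - by rewrite ltnS ltnNge (ltnW gt) ltnS leqNgt gt mulr0 oppr0 addr0.
  - by rewrite ltnn ltnSn mulr1 add0r !exprS !mulN1r !opprK.
rewrite mulrBr coefB coefMX -scalerAr coefZ coefMXn ltnS leqnn mulr0 subr0 coef_truncated_series.
case: n n2 => [|[|n]] //= _; by rewrite leqnSn !exprS mulrA mulrNN !mul1r.
Qed.

(** The first two parts carry the weight (-1)^(k-1) and all others (-1)^(k-1) / k,
so the inner sum is the coefficient of X^n in
ratio_poly n ^+ 2 * log_poly n ^+ (p - 2). *)
Lemma sum_compositions_alternating n : (2 <= n)%N ->
  \sum_(2 <= p < n.+1) (p - 2)`!%:R^-1 *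
    \sum_(k : p.-tuple 'I_n.+1 | is_composition k)
     \prod_(j < p) ((-1) ^+ (tnth k j).-1 / (if (j < 2)%N then 1 else (tnth k j)%:R))
  = (-1) ^+ n :> F.
Proof.
move=> n2; rewrite -(coef_ratio_exp_log n2) /exp_log_poly mulr_sumr coef_sum.
rewrite -{1}[2%N]add0n big_addn big_mkord (_ : n.+1 - 2 = n.-2.+1)%N; last lia.
apply: eq_bigr => q _; rewrite addnK -scalerAr coefZ; congr (_ * _).
rewrite addn2 (sum_compositions _ n (fun j i => (-1) ^+ i.-1 / (if (j < 2)%N then 1 else i%:R))).
rewrite !big_ord_recl /= expr2 mulrA; congr (nth 0 (polyseq _) n); congr (_ * _ * _).
- by apply: eq_bigr => i _; rewrite divr1.
- by apply: eq_bigr => i _; rewrite divr1.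
by rewrite prodr_const card_ord.
Qed.

(** The weights are symmetric in the parts, so any two positions t 0, t 1 of a
composition may be moved to the front; there the factors k cancel the
denominators. *)
Lemma sum_composition_pair n p (t : 'S_p.+2) :
  \sum_(k : p.+2.-tuple 'I_n.+1 | is_composition k)
     (\prod_(j < p.+2) ((-1) ^+ (tnth k j).-1 / (tnth k j)%:R))
       * (tnth k (t ord0) * tnth k (t (lift ord0 ord0)))%:R
  = \sum_(k : p.+2.-tuple 'I_n.+1 | is_composition k)
     \prod_(j < p.+2) ((-1) ^+ (tnth k j).-1 / (if (j < 2)%N then 1 else (tnth k j)%:R)) :> F.
Proof.
pose h (s : 'S_p.+2) (k : p.+2.-tuple 'I_n.+1) := [tuple tnth k (s i) | i < p.+2].
have hK s : cancel (h s) (h s^-1%g).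
  by move=> k; apply/eq_from_tnth => i; rewrite !tnth_mktuple permKV.
have hK' s : cancel (h s^-1%g) (h s) by have := hK s^-1%g; rewrite invgK.
rewrite [RHS](reindex (h t)); last by exists (h t^-1%g) => k _; [exact: hK | exact: hK'].
have hc k : is_composition (h t k) = is_composition k.
  have pk : perm_eq (h t k) k by apply/tuple_permP; exists t.
  by rewrite /is_composition (perm_all _ pk) (perm_sumn (perm_map _ pk)).
apply: eq_big => [k|k /andP[/allP k0 _]]; first by rewrite hc.
have nz j : (tnth k j)%:R != 0 :> F by rewrite pnatr_eq0 -lt0n; apply: k0; exact: mem_tnth.
rewrite (reindex_inj (@perm_inj _ t)) /= !big_ord_recl /= !tnth_mktuple !divr1.
have -> : \prod_(i < p) ((-1) ^+ (tnth (h t k) (lift ord0 (lift ord0 i))).-1 /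
      (tnth (h t k) (lift ord0 (lift ord0 i)))%:R) =
    \prod_(i < p) ((-1) ^+ (tnth k (t (lift ord0 (lift ord0 i)))).-1 /
      (tnth k (t (lift ord0 (lift ord0 i))))%:R) :> F.
  by apply: eq_bigr => i _; rewrite tnth_mktuple.
set Q := \prod_(i < p) _; rewrite natrM.
have := nz (t ord0); have := nz (t (lift ord0 ord0)).
set a := (_%:R : F); set b := (tnth k (t ord0))%:R => a0 b0.
by field; rewrite a0.
Qed.

End Compositions.

(** * The Schouten-Nijenhuis bracket as a graded biderivation *)

Section Monomials.
Variables (A : comNzRingType) (g : lmodType A).
Local Notation E := (ext g).
Local Notation W := (@ext_wedge A g).

Lemma ext_vec0 : ext_vec (0 : g) = 0.
Proof. by rewrite -[0 in LHS](scale0r 0) ext_vecZE scale0r. Qed.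

(** Zero is a monomial of every degree: this is what makes it harmless that an
element of A (+) g which is homogeneous of a degree other than 0 and 1 is 0. *)
Definition monomial (k : nat) (P : E) :=
  exists (a : A) (w : seq g), size w = k /\ P = a *: W w.

Lemma monomial0P P : monomial 0 P -> exists a : A, P = a *: (1 : E).
Proof. by move=> [a [w [/size0nil -> ->]]]; exists a; rewrite ext_wedge_nil. Qed.

Lemma monomial1P P : monomial 1 P -> exists x : g, P = ext_vec x.
Proof.
move=> [a [[|x [|y w]] [//= _ ->]]]; exists (a *: x).
by rewrite ext_wedge1 ext_vecZE.
Qed.

Lemma monomial_scalar (a : A) : monomial 0 (a *: (1 : E)).
Proof. by exists a, [::]; rewrite ext_wedge_nil. Qed.

Lemma monomial_vec (x : g) : monomial 1 (ext_vec x).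
Proof. by exists 1, [:: x]; rewrite ext_wedge1 scale1r. Qed.

Lemma monomial_null k : monomial k (0 : E).
Proof. by exists 0, (nseq k 0); rewrite size_nseq scale0r. Qed.

Lemma monomialM j k P Q : monomial j P -> monomial k Q -> monomial (j + k) (P * Q).
Proof.
move=> [a [u [<- ->]]] [b [v [<- ->]]]; exists (a * b), (u ++ v).
by rewrite size_cat ext_wedge_cat -ext_scaleAl -ext_scaleAr scalerA.
Qed.

Lemma signM_add (a b : nat) (P : E) : (-1) ^+ a * ((-1) ^+ b * P) = (-1) ^+ (a + b) * P.
Proof. by rewrite mulrA exprD. Qed.

Lemma eq_sign (a b : nat) (P : E) : odd a = odd b -> (-1) ^+ a * P = (-1) ^+ b * P.
Proof. by move=> ab; rewrite -signr_odd ab signr_odd. Qed.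

Lemma scale_sign (c : A) n (P : E) : c *: ((-1) ^+ n * P) = (-1) ^+ n * (c *: P).
Proof. by rewrite ext_scaleAr. Qed.

Lemma monomialC j k P Q : monomial j P -> monomial k Q ->
  P * Q = (-1) ^+ (j * k) * (Q * P).
Proof.
move=> [a [u [<- ->]]] [b [v [<- ->]]].
rewrite -!ext_scaleAl -!ext_scaleAr !scalerA mulrC; congr (_ *: _).
elim: v => [|y v ih]; first by rewrite ext_wedge_nil mulr1 mul1r muln0 mul1r.
rewrite ext_wedge_cons mulrA ext_wedge_vecC -!mulrA ih ext_signC signM_add.
by apply: eq_sign; rewrite mulnS.
Qed.

Lemma monomial_power k P : monomial k P -> ext_power k P.
Proof. by move=> [a [w [<- ->]]]; apply: ext_powerZ; exact: ext_power_wedge. Qed.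

End Monomials.

Section SchoutenLeibniz.
Variables (R : realType) (A : comAlgType R) (g : lmodType A) (L : LieRinehart g).
Local Notation E := (ext g).
Local Notation W := (@ext_wedge A g).
Local Notation S := (schouten L).

Lemma schoutenE : S = schE L.
Proof. exact: schouten_unique (schoutenP L) (schE_is_schouten L). Qed.

Lemma schouten_scalarl a Q : S (a *: (1 : E)) Q = ctrE L a Q.
Proof. by rewrite schoutenE -(ext_wedge_nil g) schEW /= scaler0 add0r ext_wedge_nil mul1r. Qed.

Lemma schouten_vecl x Q : S (ext_vec x) Q = lieE L x Q.
Proof.
rewrite schoutenE -ext_wedge1 -[W _]scale1r schEW /= ctrE1 ext_wedge_nil.
by rewrite !mulr0 !addr0 scale1r expr0 !mul1r add0r.
Qed.

(** Graded Leibniz rule in the left argument, for a factor y of degree 0 or 1 split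
off in front.  The bracket with y comes out to the right of P, which is the
position of the bracket in the Lie n-brackets. *)
Lemma schouten_Ml (b : bool) k y P Q : monomial b y -> monomial k P ->
  S (y * P) Q = y * S P Q + (-1) ^+ (b * k) * (P * S y Q).
Proof.
case: b => [/monomial1P[x ->]|/monomial0P[a ->]] [c [w [sw ->]]].
  rewrite schouten_vecl schoutenE -ext_scaleAr -ext_wedge_cons !schEW /= sw mul1n.
  rewrite ext_wedge_cons scalerDr mulrDr -!ext_scaleAr -ext_scaleAl -!addrA -!mulrA; congr (_ + _).
  by rewrite [LHS]addrC -ext_scaleAr.
rewrite schouten_scalarl mul0n expr0 mul1r schoutenE -ext_scaleAl mul1r scalerA !schEW.
rewrite ctrEM mulrDr -!ext_scaleAl mul1r scalerDr !scalerA -!ext_scaleAr.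
by rewrite -!addrA.
Qed.

Lemma ctrE_scale a b Q : ctrE L a (b *: Q) = b *: ctrE L a Q.
Proof.
elim/ext_span: Q => [|c w Q ih]; first by rewrite scaler0 ctrE0 scaler0.
by rewrite scalerDr !ctrED ih scalerDr scalerA !ctrEW scalerA.
Qed.

Lemma ctrE_vecM a y Q :
  ctrE L a (ext_vec y * Q) = - (lr_anchor L y a *: Q) - ext_vec y * ctrE L a Q.
Proof.
elim/ext_span: Q => [|c w Q ih]; first by rewrite mulr0 ctrE0 mulr0 scaler0 oppr0 addr0.
rewrite mulrDr !ctrED ih scalerDr mulrDr !opprD addrACA; congr (_ + _).
rewrite -ext_scaleAr -ext_wedge_cons !ctrEW /= scalerBr scalerN scalerA mulrC -scalerA.
by rewrite ext_scaleAr scalerA mulrC -scalerA [_ *: (_ *: W w)]scalerA mulrC -scalerA.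
Qed.

Lemma lieE_scale x b Q : lieE L x (b *: Q) = lr_anchor L x b *: Q + b *: lieE L x Q.
Proof.
elim/ext_span: Q => [|c w Q ih]; first by rewrite scaler0 lieE0 !scaler0 addr0.
rewrite scalerDr !lieED ih !scalerDr [RHS]addrACA; congr (_ + _).
rewrite scalerA !lieEW lr_anchorM scalerDl scalerDr !scalerA.
by rewrite addrA.
Qed.

Lemma lieE_vecM x y Q :
  lieE L x (ext_vec y * Q) = ext_vec (lr_bracket L x y) * Q + ext_vec y * lieE L x Q.
Proof.
elim/ext_span: Q => [|c w Q ih]; first by rewrite mulr0 lieE0 !mulr0 addr0.
rewrite mulrDr !lieED ih !mulrDr [RHS]addrACA; congr (_ + _).
rewrite -ext_scaleAr -ext_wedge_cons !lieEW /= scalerDr mulrDr -!ext_scaleAr ext_wedge_cons.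
by rewrite addrCA.
Qed.

Lemma ctrE_1 a : ctrE L a (1 : E) = 0.
Proof. by rewrite -(ext_wedge_nil g) -[W _]scale1r ctrEW /= scaler0. Qed.
Lemma lieE_1 x : lieE L x (1 : E) = 0.
Proof.
by rewrite -(ext_wedge_nil g) -[W _]scale1r lieEW /= lr_anchor1 scale0r scaler0 addr0.
Qed.

Lemma ctrE_vec a x : ctrE L a (ext_vec x) = - (lr_anchor L x a *: (1 : E)).
Proof. by rewrite -[ext_vec x]mulr1 ctrE_vecM ctrE_1 mulr0 subr0. Qed.
Lemma ctrE_scalar a b : ctrE L a (b *: (1 : E)) = 0.
Proof. by rewrite ctrE_scale ctrE_1 scaler0. Qed.
Lemma lieE_vec x y : lieE L x (ext_vec y) = ext_vec (lr_bracket L x y).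
Proof. by rewrite -[ext_vec y]mulr1 lieE_vecM lieE_1 mulr0 addr0 mulr1. Qed.
Lemma lieE_scalar x a : lieE L x (a *: (1 : E)) = lr_anchor L x a *: (1 : E).
Proof. by rewrite lieE_scale lieE_1 scaler0 addr0. Qed.

(** Graded Leibniz rule in the right argument when the left one, x, has degree 0
or 1: bracketing with x is a derivation of degree |x| - 1, hence the parity
b.+1 in the sign. *)
Lemma schouten_Mr (b c : bool) x y Q : monomial b x -> monomial c y ->
  S x (y * Q) = S x y * Q + (-1) ^+ (b.+1 * c) * (y * S x Q).
Proof.
case: b => [/monomial1P[u ->]|/monomial0P[a ->]];
  case: c => [/monomial1P[v ->]|/monomial0P[e ->]];
  rewrite ?schouten_vecl ?schouten_scalarl ?muln1 ?muln0 ?expr0 ?mul1r.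
- by rewrite lieE_vecM sqrrN expr1n mul1r lieE_vec.
- by rewrite lieE_scalar -!ext_scaleAl !mul1r lieE_scale.
- by rewrite ctrE_vec ctrE_vecM expr1 mulN1r mulNr -ext_scaleAl mul1r.
- by rewrite ctrE_scalar -!ext_scaleAl !mul1r ctrE_scale mul0r add0r.
Qed.

(** The bracket of x and y has degree |x| + |y| - 1.  For two scalars it vanishes,
and then it counts as the zero vector. *)
Lemma schouten_gen (b c : bool) x y : monomial b x -> monomial c y ->
  monomial (~~ (b (+) c)) (S x y).
Proof.
case: b => [/monomial1P[u ->]|/monomial0P[a ->]];
  case: c => [/monomial1P[v ->]|/monomial0P[e ->]];
  rewrite ?schouten_vecl ?schouten_scalarl /=.
- rewrite lieE_vec; exact: monomial_vec.
- rewrite lieE_scalar; exact: monomial_scalar.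
- rewrite ctrE_vec -scaleNr; exact: monomial_scalar.
- rewrite ctrE_scalar; exact: monomial_null.
Qed.

Lemma schouten_1r (b : bool) x : monomial b x -> S x 1 = 0.
Proof.
case: b => [/monomial1P[u ->]|/monomial0P[a ->]].
  by rewrite schouten_vecl lieE_1.
by rewrite schouten_scalarl ctrE_1.
Qed.

Lemma schouten_1l Q : S 1 Q = 0.
Proof. by rewrite -[1]scale1r schouten_scalarl ctrE1. Qed.

(** The graded antisymmetry of the bracket turns into graded symmetry once the sign
(-1)^b is put in front; this is why the Lie n-brackets and the binary bracket of
A (+) g can agree. *)
Lemma schouten_genC (b c : bool) x y : monomial b x -> monomial c y ->
  (-1) ^+ b * S y x = (-1) ^+ (b * c) * ((-1) ^+ c * S x y).
Proof.
case: b => [/monomial1P[u ->]|/monomial0P[a ->]];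
  case: c => [/monomial1P[v ->]|/monomial0P[e ->]];
  rewrite ?schouten_vecl ?schouten_scalarl ?(lieE_vec, lieE_scalar, ctrE_vec, ctrE_scalar) /=
    ?(mulr0, expr0, expr1, mul1r, mulN1r, opprK) //.
by rewrite (lr_bracketC L v) -[- lr_bracket _ _ _]scaleN1r ext_vecZE scaleN1r opprK.
Qed.

Lemma lr_anchor_real x (r : R) : lr_anchor L x r%:A = 0.
Proof.
have := lr_anchor_linear L x r 1 0.
by rewrite !addr0 lr_anchor1 lr_anchor0 scaler0 addr0.
Qed.

Lemma ctrE_real (r : R) Q : ctrE L r%:A Q = 0.
Proof.
elim/ext_span: Q => [|a w Q ih]; first by rewrite ctrE0.
rewrite ctrED ih ctrEW addr0; suff -> : ctr L r%:A w = 0 by rewrite scaler0.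
by elim: w => //= y w ->; rewrite lr_anchor_real scale0r mulr0 subr0 oppr0.
Qed.

(** The bracket is not linear over A, but it is over the real multiples of 1,
which every derivation annihilates. *)
Lemma schouten_realZl (r : R) P Q : S (r%:A *: P) Q = r%:A *: S P Q.
Proof.
rewrite schoutenE; elim/ext_span: P => [|a w P ih]; first by rewrite !(scaler0, schE0).
rewrite scalerDr !schEDl ih scalerDr scalerA !schEW ctrEM ctrE_real scaler0 addr0.
by rewrite scalerDr scalerA -ext_scaleAr.
Qed.

Lemma schouten_realZr (r : R) P Q : S P (r%:A *: Q) = r%:A *: S P Q.
Proof.
rewrite schoutenE; elim/ext_span: P => [|a w P ih]; first by rewrite !schE0 scaler0.
rewrite !schEDl ih !scalerDr !schEW ctrE_scale -ext_scaleAr scalerDr; congr (_ + _ + _).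
rewrite [RHS]scalerA mulrC -scalerA; congr (_ *: _).
elim: w => [|x w ihw] /=; first by rewrite scaler0.
by rewrite ihw lieE_scale lr_anchor_real scale0r add0r scalerDr -!(ext_scaleAr r%:A).
Qed.

End SchoutenLeibniz.

(** * Koszul sums and the expansion of the bracket *)

Section GradedWords.
Variables (R : realType) (A : comAlgType R) (g : lmodType A) (L : LieRinehart g).
Local Notation E := (ext g).
Local Notation S := (schouten L).
Variables (z : nat -> E) (d : nat -> bool).
Hypothesis z_mono : forall i, monomial (d i) (z i).
Local Notation deg := (word_degree d).
Local Notation kw := (koszul_word d).

(** The wedge of the letters in decreasing order of position, as in i_n and in the
tail of the Lie n-brackets. *)
Definition rev_wedge (w : seq nat) : E := \prod_(i <- rev w) z i.
Local Notation Wz := rev_wedge.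

Lemma rev_wedge_nil : Wz [::] = 1.
Proof. exact: big_nil. Qed.
Lemma rev_wedge1 i : Wz [:: i] = z i.
Proof. exact: big_seq1. Qed.
Lemma rev_wedge_cat u v : Wz (u ++ v) = Wz v * Wz u.
Proof. by rewrite /rev_wedge rev_cat big_cat. Qed.
Lemma rev_wedge_flatten bs : Wz (flatten bs) = \prod_(b <- rev bs) Wz b.
Proof.
elim: bs => [|b bs ih]; first by rewrite rev_wedge_nil big_nil.
by rewrite /= rev_wedge_cat ih rev_cons -cats1 big_cat big_seq1.
Qed.

Lemma rev_wedge_monomial w : monomial (deg w) (Wz w).
Proof.
elim: w => [|i w ih].
  rewrite rev_wedge_nil /word_degree big_nil -[1]scale1r; exact: monomial_scalar.
rewrite -cat1s rev_wedge_cat word_degree_cat addnC; apply: monomialM => //.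
by rewrite rev_wedge1 /word_degree big_seq1.
Qed.

Lemma rev_wedge_swap u i j v :
  Wz (u ++ i :: j :: v) = (-1) ^+ (d i * d j) * Wz (u ++ j :: i :: v).
Proof.
have consE a b : Wz (u ++ a :: b :: v) = Wz v * (z b * z a) * Wz u.
  rewrite rev_wedge_cat -[a :: b :: v]/([:: a] ++ [:: b] ++ v) !rev_wedge_cat !rev_wedge1.
  by rewrite !mulrA.
rewrite !consE (monomialC (z_mono j) (z_mono i)).
by rewrite ext_signC -(mulrA ((-1) ^+ _)) mulnC.
Qed.

(** The sum over all permutation words, each cut into blocks of sizes ks and
weighted by its Koszul sign.  Over all of
S_n, any fixed rearrangement of the letters can be absorbed by
reindexing. *)
Definition koszul_sum n (ks : seq nat) (Phi : seq (seq nat) -> E) : E :=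
  \sum_(w <- permutations (iota 0 n)) (-1) ^+ kw w * Phi (reshape ks w).

Lemma eq_koszul_sum n ks Phi Psi : sumn ks = n ->
  (forall bs, shape bs = ks -> perm_eq (flatten bs) (iota 0 n) -> Phi bs = Psi bs) ->
  koszul_sum n ks Phi = koszul_sum n ks Psi.
Proof.
move=> sks PhiPsi; rewrite /koszul_sum big_seq [RHS]big_seq; apply: eq_bigr => w.
rewrite mem_permutations => pw; have sw := perm_size pw; rewrite size_iota in sw.
by rewrite PhiPsi // ?reshapeKl ?reshapeKr // sw sks.
Qed.

Lemma koszul_sumD n ks Phi Psi :
  koszul_sum n ks (fun bs => Phi bs + Psi bs) = koszul_sum n ks Phi + koszul_sum n ks Psi.
Proof. by rewrite -big_split; apply: eq_bigr => w _ /=; rewrite mulrDr. Qed.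

(** The blocks of a word may be permuted under the sum at the price of the Koszul
sign of the permutation: moving blocks is a bijection on permutation words, and
koszul_word_blocks compares the signs. *)
Lemma koszul_sum_perm n ks t Phi : sumn ks = n -> perm_eq t (iota 0 (size ks)) ->
  koszul_sum n [seq nth 0%N ks j | j <- t] Phi =
  koszul_sum n ks (fun bs =>
    (-1) ^+ koszul_word (fun j => deg (nth [::] bs j)) t
      * Phi [seq nth [::] bs j | j <- t]).
Proof.
move=> sks pt; set P := permutations (iota 0 n).
have szP w : w \in P -> size w = n.
  by rewrite mem_permutations => /perm_size ->; rewrite size_iota.
have shP w : w \in P -> shape (reshape ks w) = ks.
  by move=> /szP sw; rewrite reshapeKl // sw sks.
have flP w : w \in P -> flatten (reshape ks w) = w.
  by move=> /szP sw; rewrite reshapeKr // sw sks.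
(* The list of blocks can be recovered from its rearrangement, whose shape is
   known; so moving blocks is injective on the words, hence bijective. *)
pose move_blocks (w : seq nat) := [seq nth [::] (reshape ks w) j | j <- t].
have szr w : w \in P -> size (reshape ks w) = size ks.
  by move=> /shP sh; rewrite -{2}sh size_map.
have shm w : w \in P -> shape (move_blocks w) = [seq nth 0%N ks j | j <- t].
  move=> wP; rewrite /move_blocks /shape -map_comp; apply/eq_in_map => j.
  rewrite (perm_mem pt) mem_iota /= => lj.
  by rewrite -{2}(shP w wP) /shape (nth_map [::]) ?szr.
have pm w : w \in P -> perm_eq (flatten (move_blocks w)) w.
  move=> wP; rewrite -{2}(flP w wP); apply: perm_flatten.
  have := perm_map (nth [::] (reshape ks w)) pt.
  by rewrite -(szr w wP) map_nth_iota0 ?take_size.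
have pP : perm_eq [seq flatten (move_blocks w) | w <- P] P.
  have um : uniq [seq flatten (move_blocks w) | w <- P].
    rewrite map_inj_in_uniq ?permutations_uniq // => w w' wP w'P ww'.
    have mm : move_blocks w = move_blocks w' by apply: eq_from_flatten_shape; rewrite // !shm.
    rewrite -(flP w wP) -(flP w' w'P); congr flatten.
    apply: (@eq_from_nth _ [::]) => [|j]; first by rewrite !szr.
    rewrite szr // => lj; have jt : j \in t by rewrite (perm_mem pt) mem_iota.
    by move/eq_in_map: mm; apply.
  apply: (uniq_perm um (permutations_uniq _)).
  apply: (uniq_min_size um _ _).2; last by rewrite size_map.
  move=> _ /mapP[w wP ->]; rewrite mem_permutations (perm_trans (pm w wP)) //.
  by rewrite -mem_permutations.
rewrite /koszul_sum -/P -(perm_big _ pP) /= big_map big_seq [RHS]big_seq.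
apply: eq_bigr => w wP; rewrite signM_add -{1}(shm w wP) flattenK; apply: eq_sign.
rewrite oddD -{2}(flP w wP) -koszul_word_blocks ?flP ?szr //.
by move: wP; rewrite mem_permutations => /perm_uniq ->; exact: iota_uniq.
Qed.

Definition merge_block i (bs : seq (seq nat)) :=
  take i bs ++ (nth [::] bs i ++ nth [::] bs i.+1) :: drop i.+2 bs.

Lemma reshape_merge pre a b post (w : seq nat) :
  reshape (pre ++ (a + b)%N :: post) w =
  merge_block (size pre) (reshape (pre ++ a :: b :: post) w).
Proof.
elim: pre w => [|c pre ih] w /=; last by rewrite ih.
by rewrite /merge_block /= takeD drop_drop addnC drop0.
Qed.

(** Cutting a block in two: Phi then sees the two pieces glued together. *)
Lemma koszul_sum_merge n pre a b post Phi :
  koszul_sum n (pre ++ (a + b)%N :: post) Phi =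
  koszul_sum n (pre ++ a :: b :: post) (fun bs => Phi (merge_block (size pre) bs)).
Proof. by apply: eq_bigr => w _; rewrite reshape_merge. Qed.

(** A summand of the Lie n-brackets with blocks in place of letters: the block b_0
is the right entry of the bracket, b_1 the left entry, and b_2 collects all
remaining letters.  For one-letter blocks b_0 and b_1 the Koszul sum of this
is T0. *)
Definition bracket_term (bs : seq (seq nat)) : E :=
  (-1) ^+ deg (nth [::] bs 0)
    * (Wz (nth [::] bs 2) * S (Wz (nth [::] bs 1)) (Wz (nth [::] bs 0))).
Local Notation H := bracket_term.

Lemma shape4 (a b c e : nat) (bs : seq (seq nat)) : shape bs = [:: a; b; c; e] ->
  bs = [:: nth [::] bs 0; nth [::] bs 1; nth [::] bs 2; nth [::] bs 3].
Proof. by case: bs => [|? [|? [|? [|? [|? ?]]]]]. Qed.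

(** The last letter y of a block is the first factor of its reversed wedge, so the
Leibniz rule either moves y out to the remaining letters, or leaves y alone in
the bracket and moves u out. *)
Lemma bracket_term_rcons_left b0 u y b3 :
  H [:: b0; rcons u y; b3] =
  H [:: b0; u; y :: b3] + (-1) ^+ (deg u * d y) * H [:: b0; [:: y]; u ++ b3].
Proof.
rewrite /bracket_term /= -cats1 -(cat1s y b3) !rev_wedge_cat rev_wedge1.
rewrite (schouten_Ml L _ (z_mono y) (rev_wedge_monomial u)) !mulrDr; congr (_ + _).
  by rewrite !mulrA.
rewrite -!mulrA !(ext_signC _ (Wz _)) !signM_add; apply: eq_sign.
by rewrite addnC mulnC.
Qed.

(** Same mechanism in the right entry, facing a single letter x; here the signs
record how y passes x, and u passes x and y. *)
Lemma bracket_term_rcons_right u x y b3 :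
  H [:: rcons u y; [:: x]; b3] =
  (-1) ^+ (d x * d y) * H [:: u; [:: x]; y :: b3]
  + (-1) ^+ (deg u * (d x + d y)) * H [:: [:: y]; [:: x]; u ++ b3].
Proof.
rewrite /bracket_term /= -cats1 -(cat1s y b3) !rev_wedge_cat !rev_wedge1.
rewrite word_degree_cat [deg [:: y]]big_seq1.
rewrite (schouten_Mr L _ (z_mono x) (z_mono y)) addrC !mulrDr; congr (_ + _).
  rewrite -!mulrA !(ext_signC _ (Wz _)) !signM_add; apply: eq_sign.
  by rewrite !oddD !oddM /=; do 2!case: (d _); case: (odd _).
rewrite (monomialC (schouten_gen L (z_mono x) (z_mono y)) (rev_wedge_monomial u)).
rewrite -!mulrA !(ext_signC _ (Wz _)) !signM_add; apply: eq_sign.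
by rewrite !oddD !oddM /= !oddD; do 2!case: (d _); case: (odd _).
Qed.

(** The sign in bracket_term_rcons_left is the Koszul sign of the corresponding
move of blocks, so it is absorbed by the sum. *)
Lemma koszul_sum_bracket_term_left n k0 k1 k2 : (k0 + k1.+1 + k2 = n)%N ->
  koszul_sum n [:: k0; k1.+1; k2] H =
  koszul_sum n [:: k0; k1; k2.+1] H + koszul_sum n [:: k0; 1%N; (k1 + k2)%N] H.
Proof.
move=> kn; rewrite -addn1 (koszul_sum_merge n [:: k0] k1 1 [:: k2]).
rewrite -[k2.+1]add1n (koszul_sum_merge n [:: k0; k1] 1 k2 [::]).
rewrite (koszul_sum_merge n [:: k0; 1%N] k1 k2 [::]) /=.
(* The letter y, block 2, has to be put before u, block 1. *)
rewrite (@koszul_sum_perm n [:: k0; k1; 1%N; k2] [:: 0; 2; 1; 3]%N) //=; last lia.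
rewrite -koszul_sumD; apply: eq_koszul_sum => [/=|bs sbs _]; first lia.
rewrite (shape4 sbs); move: sbs; case: bs => [|b0 [|b1 [|[|y [|? ?]] [|b3 [|? ?]]]]] //= _.
rewrite /merge_block /= cats1 bracket_term_rcons_left; congr (_ + _ * _).
rewrite -signr_odd -[RHS]signr_odd; congr (_ ^+ nat_of_bool _).
rewrite /crossing !(big_cons, big_nil) /= /word_degree !(big_cons, big_nil) /=.
by rewrite !addn0 ?muln0 ?addn0 mulnC.
Qed.

Lemma koszul_sum_bracket_term_right n k0 k2 : (k0.+1 + 1 + k2 = n)%N ->
  koszul_sum n [:: k0.+1; 1%N; k2] H =
  koszul_sum n [:: k0; 1%N; k2.+1] H + koszul_sum n [:: 1%N; 1%N; (k0 + k2)%N] H.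
Proof.
move=> kn; rewrite -addn1 (koszul_sum_merge n [::] k0 1 [:: 1%N; k2]).
rewrite -[k2.+1]add1n (koszul_sum_merge n [:: k0; 1%N] 1 k2 [::]).
rewrite (koszul_sum_merge n [:: 1%N; 1%N] k0 k2 [::]) /=.
(* The blocks are u, y, x and the rest: either x passes y, or y x passes u. *)
rewrite [X in _ = X + _](@koszul_sum_perm n [:: k0; 1%N; 1%N; k2] [:: 0; 2; 1; 3]%N) //=; last lia.
rewrite [X in _ = _ + X](@koszul_sum_perm n [:: k0; 1%N; 1%N; k2] [:: 1; 2; 0; 3]%N) //=; last lia.
rewrite -koszul_sumD; apply: eq_koszul_sum => [/=|bs sbs _]; first lia.
rewrite (shape4 sbs); move: sbs; case: bs => [|b0 [|[|y [|? ?]] [|[|x [|? ?]] [|b3 [|? ?]]]]] //= _.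
rewrite /merge_block /= cats1 bracket_term_rcons_right; congr (_ * _ + _ * _).
all: rewrite -signr_odd -[RHS]signr_odd; congr (_ ^+ nat_of_bool _).
all: rewrite /crossing !(big_cons, big_nil) /= /word_degree !(big_cons, big_nil) /=; lia.
Qed.

(** Every choice of a letter in each of the two entries contributes one copy of
T0: peel off the letters of the left entry one by one, then those of the right
entry.  An empty entry is the scalar 1, whose bracket vanishes. *)
Lemma koszul_sum_bracket_term n k0 k1 k2 : (k0 + k1 + k2 = n)%N ->
  koszul_sum n [:: k0; k1; k2] H = koszul_sum n [:: 1; 1; n - 2]%N H *+ (k0 * k1).
Proof.
have half0 k : koszul_sum n [:: k; 0%N; (n - k)%N] H = 0.
  apply: big1 => w _; rewrite /bracket_term /= take0 rev_wedge_nil schouten_1l.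
  by rewrite !mulr0.
suff H1 k : (k + 1 <= n)%N ->
    koszul_sum n [:: k; 1%N; (n - k.+1)%N] H = koszul_sum n [:: 1; 1; n - 2]%N H *+ k.
  elim: k1 k2 => [|k1 ih] k2 kn; first by (have -> : k2 = (n - k0)%N by lia); rewrite muln0 mulr0n half0.
  rewrite koszul_sum_bracket_term_left // ih; last lia.
  have -> : (k1 + k2 = n - k0.+1)%N by lia.
  by rewrite (H1 k0); last lia; rewrite mulnS mulrnDr addrC.
elim: k => [|k ih] kn.
  rewrite mulr0n; apply: big1 => w; rewrite /bracket_term /= take0 drop0 rev_wedge_nil.
  case: w => [|x w] /=; first by rewrite rev_wedge_nil schouten_1l !mulr0.
  by rewrite take0 rev_wedge1 (schouten_1r L (z_mono x)) !mulr0.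
rewrite koszul_sum_bracket_term_right; last lia.
have -> : (n - k.+2).+1 = (n - k.+1)%N by lia.
have -> : (k + (n - k.+2) = n - 2)%N by lia.
by rewrite ih ?mulrSr //; lia.
Qed.

End GradedWords.

(** * Brackets of wedges of blocks *)

Section Brackets.
Variables (R : realType) (A : comAlgType R) (g : lmodType A) (L : LieRinehart g).
Local Notation E := (ext g).
Local Notation S := (schouten L).
Variables (z : nat -> E) (d : nat -> bool).
Hypothesis z_mono : forall i, monomial (d i) (z i).
Local Notation deg := (word_degree d).
Local Notation kw := (koszul_word d).
Local Notation Wz := (rev_wedge z).
Local Notation H := (bracket_term L z d).

Lemma koszul_sign_swap u i j v (P : E) : uniq (u ++ i :: j :: v) ->
  (-1) ^+ kw (u ++ i :: j :: v) * P =
  (-1) ^+ kw (u ++ j :: i :: v) * ((-1) ^+ (d i * d j) * P).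
Proof.
move=> un; rewrite signM_add; apply: eq_sign.
rewrite oddD (@koszul_word_swap d u [:: i] [:: j] v) //.
by rewrite /word_degree !big_seq1 addbK.
Qed.

Lemma koszul_sign_swap_block pre u i j v post n (P : E) :
  perm_eq (flatten (pre ++ (u ++ i :: j :: v) :: post)) (iota 0 n) ->
  (-1) ^+ kw (flatten (pre ++ (u ++ i :: j :: v) :: post)) * P =
  (-1) ^+ kw (flatten (pre ++ (u ++ j :: i :: v) :: post)) * ((-1) ^+ (d i * d j) * P).
Proof.
move/perm_uniq; rewrite iota_uniq !flatten_cat /= -!catA /= !(catA (flatten pre)).
exact: koszul_sign_swap.
Qed.

(** The Koszul sign is by design the one that reorders a product of graded
commuting factors. *)
Lemma koszul_rev_wedge n w : perm_eq w (iota 0 n) ->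
  (-1) ^+ kw w * Wz w = Wz (iota 0 n).
Proof.
move=> pw; have -> := @perm_swap_invariant _ _ (fun w => (-1) ^+ kw w * Wz w) _ _ _ pw.
  by rewrite koszul_word_sorted ?iota_ltn_sorted // mul1r.
move=> u i j v pu; rewrite koszul_sign_swap ?(perm_uniq pu) ?(perm_uniq pw) ?iota_uniq //.
by rewrite (rev_wedge_swap z_mono u i) signrMK.
Qed.

Lemma lie_brackets_opp (B : seq E -> E) u x v :
  is_lie_brackets L B -> B (u ++ - x :: v) = - B (u ++ x :: v).
Proof.
move=> hB; apply/eqP; rewrite -addr_eq0 -(lie_bracketsD hB) addNr.
apply/eqP; apply: (addrI (B (u ++ 0 :: v))).
by rewrite -(lie_bracketsD hB) !addr0.
Qed.

Lemma lie_brackets_sign u m x v :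
  lie_brackets L (u ++ ((-1) ^+ m * x) :: v) = (-1) ^+ m * lie_brackets L (u ++ x :: v).
Proof.
rewrite -signr_odd; case: (odd m); last by rewrite !expr0 !mul1r.
by rewrite !expr1 !mulN1r lie_brackets_opp //; exact: lie_bracketsP.
Qed.

(** Exchanging two letters of a block changes the wedge of that block by the sign
that the Koszul sign compensates; by additivity the sign passes through the
bracket. *)
Lemma block_symmetric_brackets ks (c : nat -> A) :
  block_symmetric ks (fun bs => (-1) ^+ kw (flatten bs)
     * lie_brackets L [seq c (size b) *: Wz b | b <- bs]).
Proof.
move=> pre u i j v post sh pbs /=; rewrite (koszul_sign_swap_block _ pbs); congr (_ * _).
rewrite !map_cat /= (rev_wedge_swap z_mono u i) scale_sign lie_brackets_sign signrMK.
by rewrite !size_cat.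
Qed.

(** In the block of two letters the symmetry is that of the bracket itself,
schouten_genC; in the other block it is graded commutativity. *)
Lemma block_symmetric_bracket_term n :
  block_symmetric [:: 2; n]%N (fun bs => (-1) ^+ kw (flatten bs)
     * H [:: take 1 (nth [::] bs 0); drop 1 (nth [::] bs 0); nth [::] bs 1]).
Proof.
move=> pre u i j v post sh pbs /=; rewrite (koszul_sign_swap_block _ pbs); congr (_ * _).
case: pre sh {pbs} => [|k [|l pre]] sh /=; last by case: pre sh.
  have [/size0nil -> /size0nil ->] : size u = 0%N /\ size v = 0%N.
    by move: sh; rewrite /= size_cat /= => -[]; lia.
  rewrite /bracket_term /=.
  rewrite !rev_wedge1 /word_degree !big_seq1.
  rewrite -[in LHS](ext_signC _ (Wz _)) (schouten_genC L (z_mono i) (z_mono j)).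
  by rewrite !(ext_signC _ (Wz _)) signrMK.
rewrite /bracket_term /= (rev_wedge_swap z_mono u i) -!mulrA.
by rewrite (ext_signC _ ((-1) ^+ deg _)) signrMK.
Qed.

Lemma sum_shuffles_bracket_term n :
  (\sum_(w <- permutations (iota 0 n.+2) | shuffle [:: 2; n]%N w)
     (-1) ^+ kw w * H [:: take 1 w; take 1 (drop 1 w); drop 2 w]) *+ (2 * n`!)
  = koszul_sum d n.+2 [:: 1; 1; n]%N H.
Proof.
have sn : sumn [:: 2; n]%N = n.+2 by rewrite /= addn0.
have := sum_perms_shuffle sn (@block_symmetric_bracket_term n).
rewrite !big_cons big_nil muln1 => E2.
have wE w : w \in permutations (iota 0 n.+2) ->
    reshape [:: 2; n]%N w = [:: take 2 w; drop 2 w] /\ reshape [:: 1; 1; n]%N w = [:: take 1 w; take 1 (drop 1 w); drop 2 w].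
  rewrite mem_permutations => /perm_size; rewrite size_iota => sw.
  by rewrite /= drop_drop !(@take_oversize _ n) // size_drop sw !subSS subn0.
rewrite /koszul_sum.
have -> : \sum_(w <- permutations (iota 0 n.+2)) (-1) ^+ kw w * H (reshape [:: 1; 1; n]%N w) =
   \sum_(w <- permutations (iota 0 n.+2)) (-1) ^+ kw (flatten (reshape [:: 2; n]%N w)) *
     H [:: take 1 (nth [::] (reshape [:: 2; n]%N w) 0);
           drop 1 (nth [::] (reshape [:: 2; n]%N w) 0); nth [::] (reshape [:: 2; n]%N w) 1].
  rewrite big_seq [RHS]big_seq; apply: eq_bigr => w /wE[-> ->].
  by rewrite /= cats0 cat_take_drop; case: (w) => [|x [|y s]] //=; rewrite take0 drop0.
rewrite E2; congr (_ *+ _); rewrite big_seq_cond [RHS]big_seq_cond; apply: eq_bigr => w /andP[/wE[-> _] _].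
by rewrite /= cats0 cat_take_drop; case: (w) => [|x [|y s]] //=; rewrite take0 drop0.
Qed.

Variable c : nat -> R.
Local Notation scaled_wedge := (fun b : seq nat => (c (size b))%:A *: Wz b).

(** Beyond the two bracketed blocks, the wedge of the other blocks in reversed
order is the reversed wedge of their concatenation. *)
Definition merged_bracket_term (bs : seq (seq nat)) : E :=
  H [:: nth [::] bs 0; nth [::] bs 1; flatten (drop 2 bs)].

(** The summand that defines the Lie brackets, for entries that are real multiples
of wedges of blocks. *)
Lemma bracket_term_scaled bs : (2 <= size bs)%N ->
  (-1) ^+ deg (nth [::] bs 0) *
    ((\prod_(y <- rev (drop 2 [seq scaled_wedge b | b <- bs])) y)
      * S [seq scaled_wedge b | b <- bs]`_1 [seq scaled_wedge b | b <- bs]`_0)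
  = (\prod_(k <- shape bs) c k)%:A *: merged_bracket_term bs.
Proof.
case: bs => [|b0 [|b1 bs]] //= _; rewrite !drop0 !big_cons /merged_bracket_term /bracket_term /= drop0.
rewrite schouten_realZl schouten_realZr rev_wedge_flatten.
have -> : \prod_(y <- rev [seq scaled_wedge b | b <- bs]) y =
  (\prod_(k <- shape bs) c k)%:A *: \prod_(b <- rev bs) Wz b.
  elim: bs => [|b bs ih]; first by rewrite !big_nil !scale1r.
  rewrite /= !rev_cons -!cats1 !big_cat !big_seq1 big_cons ih.
  by rewrite /= -ext_scaleAr -ext_scaleAl scalerA -scalerAl mul1r scalerA.
rewrite -!ext_scaleAr -?ext_scaleAl -?ext_scaleAr !scalerA; congr (_ *: _).
by rewrite -!in_algE -!rmorphM; rewrite [in RHS]mulrCA mulrA.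
Qed.

Lemma koszul_sum_merged n ks : sumn ks = n -> (2 <= size ks)%N ->
  koszul_sum d n ks merged_bracket_term =
  koszul_sum d n [:: 1; 1; n - 2]%N H *+ (nth 0%N ks 0 * nth 0%N ks 1).
Proof.
case: ks => [|k0 [|k1 ks]] // sks _.
rewrite -(@koszul_sum_bracket_term _ _ _ L z d z_mono n k0 k1 (sumn ks)) /=; last by rewrite -sks /= addnA.
rewrite /koszul_sum big_seq [RHS]big_seq; apply: eq_bigr => w.
rewrite mem_permutations => /perm_size; rewrite size_iota => sw.
congr (_ * _); rewrite /merged_bracket_term /= drop0 /bracket_term /=; set X := drop k1 _.
have sX : size X = sumn ks by rewrite !size_drop sw -sks /=; lia.
by rewrite reshapeKr ?sX // (@take_oversize _ (sumn ks)) ?sX.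
Qed.

(** For each pair of blocks selected by t, koszul_sum_perm moves the pair to the
front and koszul_sum_bracket_term counts the choices of letters. *)
Lemma sum_brackets_blocks n p ks : sumn ks = n -> size ks = p.+2 ->
  \sum_(w <- permutations (iota 0 n)) (-1) ^+ kw w *
     lie_brackets L [seq scaled_wedge b | b <- reshape ks w]
  = \sum_(t in Sh p.+2 [:: 2; p]%N) (\prod_(k <- ks) c k)%:A *:
      (koszul_sum d n [:: 1; 1; n - 2]%N H
        *+ (nth 0%N ks (nth 0%N (perm_word t) 0) * nth 0%N ks (nth 0%N (perm_word t) 1))).
Proof.
move=> sks szks.
have brE bs : size bs = p.+2 -> shape bs = ks ->
    lie_brackets L [seq scaled_wedge b | b <- bs] =
    \sum_(t in Sh p.+2 [:: 2; p]%N) (\prod_(k <- ks) c k)%:A *: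
      ((-1) ^+ koszul_word (fun j => deg (nth [::] bs j)) (perm_word t) *
        merged_bracket_term [seq nth [::] bs j | j <- perm_word t]).
  move=> sbs shbs; pose x (i : 'I_p.+2) := scaled_wedge (nth [::] bs i).
  have bsI : bs = map (nth [::] bs) (iota 0 p.+2) by rewrite -sbs map_nth_iota0 ?take_size.
  have bsE : [seq scaled_wedge b | b <- bs] = [seq x i | i : 'I_p.+2].
    by rewrite {1}bsI -val_enum_ord -2!map_comp.
  have hx (i : 'I_p.+2) : ext_homog (Posz (deg (nth [::] bs i))) (x i).
    by apply: ext_powerZ; apply: monomial_power; exact: rev_wedge_monomial.
  rewrite bsE (lie_bracketsE (lie_bracketsP L) hx); apply: eq_bigr => t _ /=.
  have xtE : [seq x (t i) | i : 'I_p.+2] =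
      [seq scaled_wedge b | b <- [seq nth [::] bs j | j <- perm_word t]].
    by rewrite /perm_word -2!map_comp.
  have stb : size [seq nth [::] bs j | j <- perm_word t] = p.+2.
    by rewrite size_map size_perm_word.
  have degE : deg (nth [::] bs (t ord0)) = deg (nth [::] [seq nth [::] bs j | j <- perm_word t] 0).
    by rewrite (nth_map 0%N) ?size_perm_word // -(nth_perm_word t ord0).
  rewrite -mulrA degE xtE bracket_term_scaled ?stb // [RHS]scale_sign.
  rewrite (@koszul_exp_word _ _ (fun j => deg (nth [::] bs j))) //.
  suff -> : \prod_(k <- shape [seq nth [::] bs j | j <- perm_word t]) c k = \prod_(k <- ks) c k by [].
  apply: perm_big; rewrite -shbs; apply: perm_map.
  by rewrite [X in perm_eq _ X]bsI; apply/perm_map/perm_word_perm.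
transitivity (\sum_(w <- permutations (iota 0 n)) \sum_(t in Sh p.+2 [:: 2; p]%N)
   (\prod_(k <- ks) c k)%:A *: ((-1) ^+ kw w *
     ((-1) ^+ koszul_word (fun j => deg (nth [::] (reshape ks w) j)) (perm_word t) *
        merged_bracket_term [seq nth [::] (reshape ks w) j | j <- perm_word t]))).
  rewrite big_seq [RHS]big_seq; apply: eq_bigr => w.
  rewrite mem_permutations => /perm_size; rewrite size_iota => sw.
  have sh : shape (reshape ks w) = ks by rewrite reshapeKl // sw sks.
  have szr : size (reshape ks w) = p.+2 by rewrite -szks -[in RHS]sh size_map.
  rewrite (brE _ szr sh).
  by rewrite mulr_sumr; apply: eq_bigr => t _; rewrite [RHS]scale_sign.
rewrite exchange_big /=; apply: eq_bigr => t _; rewrite -scaler_sumr; congr (_ *: _).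
have pt := perm_word_perm t.
transitivity (koszul_sum d n [seq nth 0%N ks j | j <- perm_word t] merged_bracket_term).
  by rewrite koszul_sum_perm ?szks.
have st := size_perm_word t.
have ksI : ks = map (nth 0%N ks) (iota 0 p.+2) by rewrite -szks map_nth_iota0 ?take_size.
have skt : sumn [seq nth 0%N ks j | j <- perm_word t] = n.
  by rewrite -sks [X in _ = sumn X]ksI; apply/perm_sumn/perm_map.
have szt : (1 < size [seq nth 0%N ks j | j <- perm_word t])%N by rewrite size_map st.
rewrite (koszul_sum_merged skt szt).
by rewrite !(nth_map 0%N) ?st.
Qed.

End Brackets.

(** * The maps between the two graded spaces *)

Section Injection.
Variables (R : realType) (A : comAlgType R) (g : lmodType A).
Local Notation E := (ext g).
Local Notation V := (assoc_graded g).
Local Notation toE := (@assoc_graded_ext R A g).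

Definition injection_coef (m : nat) : R := (-1) ^+ (m - 1) * (m - 1)`!%:R.

Lemma ext_graded_scale (r : R) (x : ext_graded g) : r *: x = (r%:A *: (x : E) : E).
Proof. by []. Qed.

Lemma ext_graded_sign k (x : ext_graded g) : (-1) ^+ k *: x = ((-1) ^+ k * (x : E) : E).
Proof.
rewrite -signr_odd -[in RHS]signr_odd; case: (odd k).
  by rewrite !expr1 scaleN1r mulN1r.
by rewrite !expr0 scale1r mul1r.
Qed.

Lemma toE_linear (k : R) (x y : V) : toE (k *: x + y) = k%:A *: toE x + toE y.
Proof.
rewrite /assoc_graded_ext.
have -> : (k *: x + y).1 = ((k%:A : A) * (x.1 : A) + (y.1 : A) : A) by [].
have -> : (k *: x + y).2 = ((k%:A : A) *: (x.2 : g) + (y.2 : g) : g) by [].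
by rewrite ext_vecDE ext_vecZE scalerDl scalerDr scalerA addrACA.
Qed.

Lemma toE0 : toE 0 = 0.
Proof. by have := toE_linear (-1) 0 0; rewrite scaleN1r addNr !scaleN1r addNr. Qed.

Lemma i_inftyE w :
  i_infty w = ((injection_coef (size w))%:A *: \prod_(x <- rev w) toE x : E).
Proof. by []. Qed.

Lemma i_infty_multilinear : multilinear (@i_infty R A g).
Proof.
move=> u v k x y; rewrite ext_graded_scale !i_inftyE !size_cat /=.
set c := (injection_coef _)%:A; pose P y := \prod_(w <- rev (u ++ y :: v)) toE w.
have PE : P (k *: x + y) = k%:A *: P x + P y.
  rewrite /P !rev_cat !big_cat !rev_cons -!cats1 !big_cat !big_seq1 /= toE_linear.
  by rewrite mulrDr !mulrDl -ext_scaleAr -ext_scaleAl.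
transitivity (k%:A *: (c *: P x) + c *: P y : E); last by [].
by rewrite -/(P _) PE scalerDr !scalerA mulrC.
Qed.

Lemma i_infty0 u v : i_infty (u ++ 0 :: v) = 0 :> E.
Proof.
rewrite i_inftyE rev_cat big_cat rev_cons -cats1 big_cat big_seq1 /= toE0.
by rewrite mulr0 mul0r scaler0.
Qed.

Section Letters.
Variables (n : nat) (d : 'I_n -> int) (v : 'I_n -> V).
Hypothesis v_homog : forall i, homog (d i) (v i).

(** Words range over all natural numbers, so letters beyond position n default to
0, in degree 0; then the homogeneity statements below hold for every j. *)
Definition letter (j : nat) : V := nth 0 [seq v i | i : 'I_n] j.
Definition letter_ext (j : nat) : E := toE (letter j).
(** Only the parity of the degrees enters the signs, and for a nonzero letter the
parity is the degree. *)
Definition letter_odd (j : nat) : bool := odd `|nth 0%R [seq d i | i : 'I_n] j|.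
Local Notation z := letter_ext.
Local Notation dz := letter_odd.

Lemma letter_homog j : assoc_graded_homog (nth 0%R [seq d i | i : 'I_n] j) (letter j).
Proof.
have [lt|le] := ltnP j n; last by rewrite /letter !nth_default ?size_image ?card_ord.
by rewrite /letter -[j]/(nat_of_ord (Ordinal lt)) !nth_image_ord; exact: v_homog.
Qed.

Lemma letter_monomial j : monomial (dz j) (z j).
Proof.
rewrite /dz /z; have := letter_homog j; case: (letter j) => a x.
case: (nth _ _ _) => [[|[|k]]|k]; rewrite /assoc_graded_ext /=.
- by move=> ->; rewrite ext_vec0 addr0; exact: monomial_scalar.
- by move=> ->; rewrite scale0r add0r; exact: monomial_vec.
- by case=> -> ->; rewrite ext_vec0 addr0 scale0r; exact: monomial_null.
- by case=> -> ->; rewrite ext_vec0 addr0 scale0r; exact: monomial_null.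
Qed.

Lemma map_letter (s : 'S_n) : [seq v (s i) | i : 'I_n] = map letter (perm_word s).
Proof. exact: map_perm_word. Qed.

Lemma koszul_exp_letter s (x : E) :
  (-1) ^+ koszul_exp d s * x = (-1) ^+ koszul_word dz (perm_word s) * x.
Proof.
congr (_ * _); rewrite -(@koszul_exp_word n (fun i => Posz (dz i)) dz s) //.
apply: sign_koszul => i; rewrite /dz nth_image_ord /=.
by rewrite oddb.
Qed.

Lemma i_infty_letter w :
  i_infty (map letter w) = ((injection_coef (size w))%:A *: rev_wedge z w : E).
Proof. by rewrite i_inftyE size_map -map_rev big_map. Qed.

End Letters.

Lemma i_infty_symmetric : graded_symmetric (@i_infty R A g).
Proof.
move=> n d v s _ hv; rewrite ext_graded_sign.
have -> : [seq v i | i : 'I_n] = [seq v ((1%g : 'S_n) i) | i : 'I_n].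
  by apply: eq_map => i; rewrite perm1.
rewrite !map_letter !i_infty_letter !size_perm_word koszul_exp_letter -scale_sign.
congr (_ *: _); rewrite (koszul_rev_wedge (letter_monomial hv) (perm_word_perm s)).
by rewrite perm_word1.
Qed.

Lemma i_infty_degree : of_degree 0 (@i_infty R A g).
Proof.
(* A letter of degree other than 0 and 1 is 0, and then so is the wedge. *)
move=> n d v _ hv; have [/existsP[i /eqP vi]|/existsPn nz] := boolP [exists i, v i == 0].
  suff -> : i_infty [seq v i | i : 'I_n] = 0 by exact: homog0.
  have -> : [seq v i | i : 'I_n] = take i [seq v i | i : 'I_n] ++ 0 :: drop i.+1 [seq v i | i : 'I_n].
    rewrite -[LHS](cat_take_drop i) (drop_nth 0) ?size_image ?card_ord //.
    by rewrite nth_image_ord vi.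
  exact: i_infty0.
have dE i : d i = Posz (letter_odd d i).
  rewrite /letter_odd nth_image_ord.
  have := hv i; case: (d i) => [[|[|k]]|k] //= vi.
  - by move: (nz i); rewrite vi eqxx.
  - by move: (nz i); rewrite vi eqxx.
rewrite addr0 (eq_bigr _ (fun i _ => dE i)) -(big_morph Posz PoszD (erefl _)).
have -> : [seq v i | i : 'I_n] = [seq v ((1%g : 'S_n) i) | i : 'I_n].
  by apply: eq_map => i; rewrite perm1.
rewrite map_letter i_infty_letter.
apply: ext_powerZ.
have -> : (\sum_(i < n) letter_odd d i = word_degree (letter_odd d) (perm_word (1%g : 'S_n)))%N.
  rewrite /word_degree big_map big_enum /=; apply: eq_bigr => i _; by rewrite perm1.
exact/monomial_power/rev_wedge_monomial/letter_monomial.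
Qed.

End Injection.

(** * The morphism equation *)

Section MorphismEquation.
Variables (R : realType) (A : comAlgType R) (g : lmodType A) (L : LieRinehart g).
Local Notation E := (ext g).
Local Notation V := (assoc_graded g).
Local Notation S := (schouten L).
Local Notation toE := (@assoc_graded_ext R A g).
Variables (n : nat) (d : 'I_n -> int) (v : 'I_n -> V).
Hypothesis v_homog : forall i, homog (d i) (v i).
Local Notation letter := (letter v).
Local Notation z := (letter_ext v).
Local Notation dz := (letter_odd d).
Local Notation H := (bracket_term L z dz).
Local Notation T0 := (koszul_sum dz n [:: 1; 1; n - 2]%N H).

Lemma letter_parity j : if dz j then (letter j).1 = 0 else (letter j).2 = 0.
Proof.
have := letter_homog v_homog j; rewrite /letter_odd.
by case: (nth _ _ _) => [[|[|m]]|m] //= ->; case: ifP.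
Qed.

(** The binary bracket of A (+) g is the Schouten-Nijenhuis bracket of the two
elements in opposite order, up to the sign e(x_1) that also enters the Lie
n-brackets. *)
Lemma graded_bracket_schouten i j :
  toE (assoc_graded_brackets L [:: letter i; letter j]) = (-1) ^+ dz i * S (z j) (z i).
Proof.
have := letter_parity i; have := letter_parity j; rewrite /letter_ext /assoc_graded_ext.
have anchor0 a : lr_anchor L 0 a = 0 by rewrite -[0 in LHS](scale0r 0) lr_anchorZ mul0r.
have bracket0r x : lr_bracket L x 0 = 0.
  by apply: (addrI (lr_bracket L x 0)); rewrite -lr_bracketDr !addr0.
have bracket0l x : lr_bracket L 0 x = 0 by rewrite lr_bracketC bracket0r oppr0.
case: (letter i) (letter j) (dz i) (dz j) => [a x] [b y] [] [] /= -> ->;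
  rewrite ?(anchor0, bracket0r, bracket0l, ext_vec0, lr_anchor0, addr0, add0r, scale0r,
    expr0, expr1, mul1r, mulN1r).
- rewrite schouten_vecl lieE_vec.
  by rewrite (lr_bracketC L x) -[- lr_bracket _ _ _]scaleN1r ext_vecZE scaleN1r.
- by rewrite (schouten_scalar_vec (schoutenP L)) opprK.
- by rewrite (schouten_vec_scalar (schoutenP L)).
- by rewrite (schouten_scalars (schoutenP L)).
Qed.

Lemma i_infty_bracket_letters w : (2 <= size w)%N ->
  i_infty (assoc_graded_brackets L (take 2 (map letter w)) :: drop 2 (map letter w)) =
  ((injection_coef R (size w - 1))%:A *: H [:: take 1 w; take 1 (drop 1 w); drop 2 w] : E).
Proof.
case: w => [|i [|j w]] // _.
rewrite /= take0 drop0 !take0 drop0 i_inftyE /= size_map subSS subn0; congr (_ *: _).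
rewrite rev_cons -cats1 big_cat big_seq1 /= graded_bracket_schouten.
rewrite /bracket_term /= !rev_wedge1 /word_degree big_seq1 -map_rev big_map.
by rewrite (ext_signC _ (\prod_(_ <- _) _)).
Qed.

Lemma morphism_lhs : (2 <= n)%N ->
  \sum_(1 <= q < n.+1) \sum_(s in Sh n [:: q; (n - q)%N])
      (let vs := [seq v (s i) | i : 'I_n] in
       (-1) ^+ koszul_exp d s *: i_infty (assoc_graded_brackets L (take q vs) :: drop q vs))
  = (((-1) ^+ n / 2)%:A *: T0 : E).
Proof.
(* Only the binary bracket of A (+) g is nonzero, which selects q = 2. *)
move=> n2; rewrite (bigD1_seq 2%N) ?iota_uniq ?mem_index_iota //= [X in _ + X]big1_seq; last first.
  move=> q /andP[/= q2]; rewrite mem_index_iota => /andP[q1 qn]; apply: big1 => s _.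
  have -> : assoc_graded_brackets L (take q [seq v (s i) | i : 'I_n]) = 0.
    have : size (take q [seq v (s i) | i : 'I_n]) != 2%N.
      by rewrite size_take size_image card_ord; case: ltnP => //; lia.
    by case: (take _ _) => [|[a x] [|[b y] [|? ?]]].
  by rewrite (i_infty0 [::]) scaler0.
rewrite addr0.
transitivity (\sum_(s in Sh n [:: 2; n - 2]%N) ((-1) ^+ koszul_word dz (perm_word s) *
   ((injection_coef R (n - 1))%:A *: H [:: take 1 (perm_word s); take 1 (drop 1 (perm_word s)); drop 2 (perm_word s)]) : E)).
  apply: eq_bigr => s _; rewrite map_letter i_infty_bracket_letters ?size_perm_word //.
  by rewrite ext_graded_sign koszul_exp_letter.
rewrite (sum_Sh_word _ _ (fun w => (-1) ^+ koszul_word dz w *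
   ((injection_coef R (n - 1))%:A *: H [:: take 1 w; take 1 (drop 1 w); drop 2 w]) : E)).
have nE : n = (n - 2).+2 by lia.
have X := sum_shuffles_bracket_term L (letter_monomial v_homog) (n - 2); rewrite -nE in X.
rewrite -X -scalerMnr !scalerMnl scaler_sumr.
(* The left side carries i_(n-1); its (n - 2)! cancels against the size of the
   fibres of the shuffles. *)
have -> : ((-1) ^+ n / 2 *+ (2 * (n - 2)`!)) = injection_coef R (n - 1).
  rewrite /injection_coef -subnDA {1}nE !exprS !mulN1r opprK -mulr_natr natrM.
  by rewrite mulrA mulfVK ?pnatr_eq0.
by apply: eq_bigr => w _; rewrite [RHS]scale_sign.
Qed.

Definition block_coef (k : nat) : R := injection_coef R k / k`!%:R.

(** The term of the right side for a fixed composition, after passing from shuffles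
to all permutations, is a multiple of T0 with one contribution for every pair of
blocks. *)
Lemma composition_term p (ks : seq nat) : sumn ks = n -> size ks = p.+2 ->
  \sum_(s in Sh n ks)
     (let vs := [seq v (s i) | i : 'I_n] in
      (-1) ^+ koszul_exp d s *:
        ext_graded_brackets L [seq i_infty b | b <- reshape ks vs])
  = (\sum_(t in Sh p.+2 [:: 2; p]%N) (\prod_(k <- ks) block_coef k
      * (nth 0%N ks (nth 0%N (perm_word t) 0) * nth 0%N ks (nth 0%N (perm_word t) 1))%:R)%:A *: T0 : E).
Proof.
move=> sks szks.
pose f bs : E := (-1) ^+ koszul_word dz (flatten bs) *
  lie_brackets L [seq (injection_coef R (size b))%:A *: rev_wedge z b | b <- bs].
have fP w : w \in permutations (iota 0 n) -> flatten (reshape ks w) = w.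
  by rewrite mem_permutations => /perm_size; rewrite size_iota => sw; rewrite reshapeKr // sw sks.
transitivity (\sum_(s in Sh n ks) f (reshape ks (perm_word s))).
  apply: eq_bigr => s _ /=; rewrite ext_graded_sign koszul_exp_letter /f fP; last first.
    by rewrite mem_permutations perm_word_perm.
  rewrite map_letter -map_reshape -map_comp; congr (_ * lie_brackets L _).
  by apply: eq_map => b /=; rewrite i_infty_letter.
rewrite (sum_Sh_word _ _ (fun w => f (reshape ks w))).
have := sum_perms_shuffle sks (block_symmetric_brackets L (letter_monomial v_homog)
  (fun k => (injection_coef R k)%:A)).
rewrite -/f; set Y := (\sum_(w <- _ | shuffle ks w) _ : E) => X.
have {X}Y_E : Y *+ \prod_(k <- ks) k`! = \sum_(t in Sh p.+2 [:: 2; p]%N)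
    (\prod_(k <- ks) injection_coef R k)%:A *: (T0 *+
      (nth 0%N ks (nth 0%N (perm_word t) 0) * nth 0%N ks (nth 0%N (perm_word t) 1))).
  rewrite -(sum_brackets_blocks L (letter_monomial v_homog) _ sks szks) -X.
  by rewrite big_seq [RHS]big_seq; apply: eq_bigr => w /fP ww; rewrite /f ww.
have nz : (\prod_(k <- ks) k`!)%:R != 0 :> R.
  by rewrite pnatr_eq0 -lt0n prodn_gt0 // => k; exact: fact_gt0.
have -> : Y = ((\prod_(k <- ks) k`!)%:R^-1 : R)%:A *: (Y *+ \prod_(k <- ks) k`!).
  by rewrite -scalerMnr !scalerMnl -mulr_natr mulVf // !scale1r.
rewrite Y_E scaler_sumr; apply: eq_bigr => t _.
rewrite -!scalerMnr !scalerMnl scalerA -scalerAl mul1r scalerA; congr (_%:A *: _).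
rewrite /block_coef prodf_div natr_prod mulr_natr mulrC.
by rewrite mulrnAr.
Qed.

Lemma block_coefE k : (0 < k)%N -> block_coef k = (-1) ^+ k.-1 / k%:R.
Proof.
case: k => // k _; rewrite /block_coef /injection_coef subn1 /= factS natrM invfM.
by rewrite -!mulrA (mulrCA k`!%:R) mulfV ?mulr1 // pnatr_eq0 -lt0n fact_gt0.
Qed.

Lemma morphism_rhs : (2 <= n)%N ->
  \sum_(1 <= p < n.+1) (p`!%:R)^-1 *:
        \sum_(k : p.-tuple 'I_n.+1 |
               all (fun j : 'I_n.+1 => (0 < j)%N) k &&
               (sumn [seq nat_of_ord j | j <- k] == n))
        \sum_(s in Sh n [seq nat_of_ord j | j <- k])
          (let vs := [seq v (s i) | i : 'I_n] in
           (-1) ^+ koszul_exp d s *: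
             ext_graded_brackets L
               [seq i_infty b | b <- reshape [seq nat_of_ord j | j <- k] vs])
  = (((-1) ^+ n / 2)%:A *: T0 : E).
Proof.
(* The term p = 1 vanishes with the Lie 1-bracket. *)
move=> n2; rewrite big_ltn ?ltnS ?(ltnW n2) // big1 => [|k _]; last first.
  apply: big1 => s _ /=; rewrite /ext_graded_brackets.
  case: k => [[|k0 [|? ?]] //= _].
  by rewrite (lie_brackets1 (lie_bracketsP L)) scaler0.
rewrite scaler0 add0r -(sum_compositions_alternating R n2) mulr_suml.
transitivity (\sum_(2 <= p < n.+1) (((p - 2)`!%:R^-1 *
    (\sum_(k : p.-tuple 'I_n.+1 | is_composition k)
     \prod_(j < p) ((-1) ^+ (tnth k j).-1 / (if (j < 2)%N then 1 else (tnth k j)%:R))) / 2 : R)%:A *: T0 : E));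
  last by rewrite !scaler_suml.
rewrite big_nat_cond [RHS]big_nat_cond; apply: eq_bigr => p /andP[/andP[p2 pn] _].
case: p p2 pn => [|[|p]] // _ pn.
set C := (\sum_(k | is_composition k) _ : R).
transitivity ((p.+2`!%:R^-1 : R) *: ((\sum_(t in Sh p.+2 [:: 2; p]%N) C%:A *: T0 : E) : ext_graded g)).
  congr (_ *: _).
  transitivity (\sum_(k : p.+2.-tuple 'I_n.+1 | is_composition k)
    \sum_(t in Sh p.+2 [:: 2; p]%N)
     ((\prod_(j < p.+2) ((-1) ^+ (tnth k j).-1 / (tnth k j)%:R))
       * (tnth k (t ord0) * tnth k (t (lift ord0 ord0)))%:R)%:A *: T0 : E).
    apply: eq_bigr => k /andP[/allP k0 /eqP sk].
    rewrite (@composition_term p _ sk) ?size_map ?size_tuple //.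
    apply: eq_bigr => t _; congr ((_ * _%:R)%:A *: _).
      rewrite big_map big_tuple; apply: eq_bigr => j _.
      by rewrite block_coefE // k0 // mem_tnth.
    rewrite (nth_perm_word t ord0) (nth_perm_word t (lift ord0 ord0)).
    by rewrite !(nth_map ord0) ?size_tuple ?ltn_ord // -!tnth_nth.
  rewrite exchange_big /=; apply: eq_bigr => t _.
  by rewrite -!scaler_suml sum_composition_pair.
rewrite ext_graded_scale sumr_const scalerMnl scalerA scalerMnl -scalerAl mul1r scalerA.
congr (_%:A *: _); rewrite -(mulr_natr C) card_Sh_2 subSS subSS subn0.
have nz m : m`!%:R != 0 :> R by rewrite pnatr_eq0 -lt0n fact_gt0.
by rewrite natrM; field; rewrite !nz.
Qed.

End MorphismEquation.

Theorem theorem3p6 (R : realType) (A : comAlgType R) (g : lmodType A)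
    (L : LieRinehart g) :
  Linfty_morphism (V := assoc_graded g) (W := ext_graded g)
    (assoc_graded_brackets L) (ext_graded_brackets L) (@i_infty R A g).
Proof.
split; [exact: i_infty_multilinear | exact: i_infty_symmetric | exact: i_infty_degree |].
move=> n d v n0 hv; case: (leqP 2 n) => n2.
  by rewrite (morphism_lhs L hv n2) (morphism_rhs L hv n2).
have n1 : n = 1%N by lia.
move: d v hv {n0 n2}; rewrite n1 => d v hv.
rewrite !big_nat1 !big1 ?scaler0 // => [k _|s _].
  apply: big1 => s _ /=; rewrite /ext_graded_brackets.
  case: k => [[|k0 [|? ?]] //= _].
  by rewrite (lie_brackets1 (lie_bracketsP L)) scaler0.
rewrite /=; have -> : assoc_graded_brackets L (take 1 [seq v (s i) | i : 'I_1]) = 0.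
  by case: [seq _ | _ : _] => [|[a x] r] //=; rewrite take0.
by rewrite /= (i_infty0 [::]) scaler0.
Qed.
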